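(* Let $O=(0,0)$ and let $P=(x,y)$, with $0<x<1$, be a point of the planar interception curve (defined in the context). Let $Q$ be the point where the line $OP$ meets the line $X=1$, and let $T$ be the point where the tangent line of the curve at $P$ meets the line $X=1$. Then the length of the side $PQ$ and the difference of the lengths of the other two sides of $\triangle PQT$ approach the same limit $B^2$ as $x\to 1^-$: $$\lim_{x\to1^-}|PQ|=\lim_{x\to1^-}\left(|PT|-|TQ|\right)=\frac{\Gamma\left(\frac34\right)^4}{2\pi}=B^2\approx 0.3588850048,$$ where $B$ is the second lemniscate constant.
   Context: The planar interception curve is the graph of the function $y=y(x)$, $0\le x<1$, starting at the origin, such that the arc length of the curve from $O$ to $P=(x,y(x))$ equals the length $y/x$ of the segment $AQ$ for $0<x<1$, where $A=(1,0)$ and $Q=(1,y/x)$ is the point of the line $X=1$ on the ray $OP$: $\int_0^x\sqrt{1+(y'(t))^2}\,dt=y/x$. Equivalently, it satisfies the differential equation $x^2\sqrt{1+(y'(x))^2}=x\,y'(x)-y(x)$ with $y(0)=0$, and is parametrized by the slope $p=y'(x)\ge 0$ as $$x(p)=\frac{1}{\sqrt[4]{p^2+1}}\int_0^p\frac{dt}{2\sqrt[4]{t^2+1}},\qquad y(p)=p\,x(p)-(x(p))^2\sqrt{p^2+1}\quad(p\ge 0).$$ The second lemniscate constant is $B=\int_0^1\frac{x^2\,dx}{\sqrt{1-x^4}}$. $|XY|$ denotes the Euclidean distance between points $X$ and $Y$, and $\Gamma$ is the Gamma function.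
   Formalization: The printed decimal 0.3588850048 is inaccurate in its last two digits, as B² = 0.3588850055…; the approximation is therefore stated as: B² differs from 0.3588850048 by less than 10⁻⁹. *)

(* Defs.v *)
From Stdlib Require Import Reals.
From Coquelicot Require Import Coquelicot.
Open Scope R_scope.

Definition point : Type := (R * R)%type.

Definition origin : point := (0, 0).

Definition euclid_dist (X Y : point) : R := dist_euc (fst X) (snd X) (fst Y) (snd Y).

Definition graph_point (y : R -> R) (x : R) : point := (x, y x).

(* The line through the point M with direction vector d (used with d <> 0). *)
Definition on_line (M d X : point) : Prop :=
  exists t : R, X = (fst M + t * fst d, snd M + t * snd d).

Definition line_through (M N X : point) : Prop :=
  on_line M (fst N - fst M, snd N - snd M) X.

Definition tangent_line (y : R -> R) (x : R) (X : point) : Prop :=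
  on_line (graph_point y x) (1, Derive y x) X.

Definition vertical_line (a : R) (X : point) : Prop := fst X = a.

(* Only the values of y on [0,1) matter: the value at the single point 0 of the
   two-sided derivative Derive y does not affect the integral below.  No
   regularity is assumed beyond differentiability on (0,1) and (Riemann)
   integrability of the arc length element, which is part of is_RInt. *)
Definition interception_curve (y : R -> R) : Prop :=
  y 0 = 0 /\
  (forall x : R, 0 < x < 1 -> ex_derive y x) /\
  (forall x : R, 0 < x < 1 ->
     is_RInt (fun t => sqrt (1 + (Derive y t) ^ 2)) 0 x (y x / x)).

(* The integrand is unbounded at 1, hence the improper integral. *)
Definition second_lemniscate_constant : R :=
  RInt_gen (fun x => x ^ 2 / sqrt (1 - x ^ 4)) (at_point 0) (at_left 1).

(* Euler's integral, meaningful for s > 0; improper at both ends (at 0 when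
   s < 1). *)
Definition Gamma (s : R) : R :=
  RInt_gen (fun t => Rpower t (s - 1) * exp (- t))
    (at_right 0) (Rbar_locally p_infty).

(* Main.v *)
Require Import Defs.
From Stdlib Require Import Reals Lra Lia RList.
From Coquelicot Require Import Coquelicot.
Open Scope R_scope.

(** Write [s = y / x] for the height of [Q], [p] for the slope [y'] and
    [J = sqrt (1 + p^2)].

    _The curve._  Differentiating the arc length condition gives [s' = J], and
    [y = x s] gives [p = s + x J].  Hence
    [|TQ| = (1 - x) (p - s) = (1 - x) x J], while [|PT| = (1 - x) J], so that
    [|PT| - |TQ| = (1 - x)^2 J].  Differentiating
    [s = p - x J] yields [(1 - x p / J) p' = 2 J], which is a linear equation
    for [x] as a function of [p]; it says that
    [x sqrt J - I p] is constant, where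
    [I p] is the integral of [1 / (2 (1 + t^2)^(1/4))] over [[0, p]]
    ([slope_parametrization]).  Therefore [(1 - x) sqrt J = sqrt J - I p], and
    since [p] tends to infinity as [x] tends to [1], both lengths tend to the
    square of the limit of [sqrt J - I p]; the length [|PQ|] differs from
    [(1 - x)^2 J] by at most [1 - x].
    The arc length condition is only an identity between Riemann integrals of a
    possibly discontinuous function, so [s' = J] is not immediate.  It follows
    from [constant_of_integrand_bound]: a Riemann integrable function is within
    a step function of small integral from the derivative of its primitive,
    wherever that derivative exists.

    _The constant._  The substitution [v^2 = J - p] turns [sqrt J - I p]
    into [L + sqrt 2 * N v] with [N v] the integral of
    [x^2 / sqrt (1 + x^4)] over [[0, v]] and [L = 1 - sqrt 2 * N 1]
    ([slope_defect_eq]).  The substitution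
    [b^2 = 2 v^2 / (1 + v^4)] turns the integral defining the
    lemniscate constant into one of the same family, with value [L] as well
    ([second_lemniscate_constant_eq]).  All later computations use [L], an
    integral of a smooth function over a compact interval.

    _The Gamma value._  With [t = w^4], [Gamma (3/4)] is four times the
    integral of [w^2 exp (- w^4)].  Its square is a double integral, which is
    computed along rays from the origin ([primitive_sqr]); the radial part is a
    Gaussian moment, equal to [sqrt PI / 4], and the angular part is
    [L / (2 sqrt 2)].  The Gaussian integral comes from the same lemma.

    _The numerical value._  The moments [r_n] of [x^4 / (1 + x^4)], which is at
    most [1/2] on [[0, 1]], for the density [sqrt 2 x^2 / sqrt (1 + x^4)] satisfy
    [(4 n + 3) r_n = 2^(-n) + (4 n + 2) r_(n+1)] and [L = 1 - r_0]; thirty steps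
    of this recurrence locate [L] with an error below [10^(-9)]. *)

(** * Derivatives, primitives and improper integrals *)

Ltac nz := repeat split; try exact I; try lra; try (apply Rgt_not_eq; lra).

Lemma is_derive_eq (f : R -> R) (x l1 l2 : R) :
  l1 = l2 -> is_derive f x l1 -> is_derive f x l2.
Proof. now intros ->. Qed.

Lemma is_derive_primitive (f : R -> R) (a x : R) :
  (forall z, continuous f z) -> is_derive (fun u => RInt f a u) x (f x).
Proof.
  intros Hf. apply (is_derive_RInt f (fun u => RInt f a u) a x).
  - apply filter_forall. intros u. apply (@RInt_correct R_CompleteNormedModule).
    apply (@ex_RInt_continuous R_CompleteNormedModule). intros z _. apply Hf.
  - apply Hf.
Qed.

Lemma continuous_of_ex_derive (f : R -> R) (x : R) : ex_derive f x -> continuous f x.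
Proof. apply (@ex_derive_continuous R_AbsRing R_NormedModule). Qed.

Lemma ball_Rabs_def2 (a b : R) (eps : posreal) :
  ball a eps b -> b - a < eps /\ - eps < b - a.
Proof. apply Rabs_def2. Qed.

Lemma constant_of_derive_0 (f : R -> R) (a b : R) : a < b ->
  (forall x, a < x < b -> is_derive f x 0) ->
  (forall x, a <= x <= b -> continuity_pt f x) -> f b = f a.
Proof.
  intros Hab Hd Hc.
  destruct (MVT_gen f a b (fun _ => 0)) as [c [_ Hc']].
  - rewrite Rmin_left, Rmax_right by lra. exact Hd.
  - rewrite Rmin_left, Rmax_right by lra. exact Hc.
  - lra.
Qed.

Lemma is_RInt_gen_primitive (f F : R -> R) (Fa Fb : (R -> Prop) -> Prop)
  {FFa : Filter Fa} {FFb : Filter Fb} (la lb : R) :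
  filter_prod Fa Fb (fun ab => forall x,
    Rmin (fst ab) (snd ab) <= x <= Rmax (fst ab) (snd ab) ->
    is_derive F x (f x) /\ continuous f x) ->
  filterlim F Fa (locally la) -> filterlim F Fb (locally lb) ->
  is_RInt_gen f Fa Fb (lb - la).
Proof.
  intros Hd Ha Hb P HP.
  assert (HF : filterlim (fun ab : R * R => minus (F (snd ab)) (F (fst ab)))
            (filter_prod Fa Fb) (locally (minus lb la))).
  { apply (filterlim_comp_2 (G := locally lb) (H := locally (opp la))
      (fun ab : R * R => F (snd ab)) (fun ab : R * R => opp (F (fst ab))) plus).
    - apply (filterlim_comp _ _ _ snd F _ Fb); [apply filterlim_snd | exact Hb].
    - apply (filterlim_comp _ _ _ (fun ab : R * R => F (fst ab)) opp _ (locally la)).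
      + apply (filterlim_comp _ _ _ fst F _ Fa); [apply filterlim_fst | exact Ha].
      + apply (@filterlim_opp R_AbsRing R_NormedModule).
    - apply (@filterlim_plus R_AbsRing R_NormedModule). }
  specialize (HF P HP). unfold filtermapi, filtermap in *.
  generalize (filter_and _ _ Hd HF). apply filter_imp.
  intros [a b] [H1 H2]. simpl in *.
  exists (minus (F b) (F a)). split; [|exact H2].
  apply (@is_RInt_derive R_CompleteNormedModule F f); intros x Hx; now apply H1.
Qed.

Lemma at_left_1_unit : at_left 1 (fun x => 0 < x < 1).
Proof.
  exists (mkposreal 1 Rlt_0_1). intros x Hx Hx1.
  apply ball_Rabs_def2 in Hx; simpl in Hx. lra.
Qed.

Lemma filterlim_at_left_continuous (f : R -> R) (x : R) :
  continuous f x -> filterlim f (at_left x) (locally (f x)).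
Proof.
  intros Hf. eapply filterlim_filter_le_1; [apply filter_le_within|exact Hf].
Qed.

(** * The lemniscate constant as a proper integral *)

Definition lemn_integrand (x : R) : R := x ^ 2 / sqrt (1 + x ^ 4).
Definition lemn_primitive (v : R) : R := RInt lemn_integrand 0 v.
(** The value of the second lemniscate constant, as a proper integral of a
    smooth function. *)
Definition lemn_B : R := 1 - sqrt 2 * lemn_primitive 1.

Lemma pow4_ge_0 (x : R) : 0 <= x ^ 4.
Proof. replace (x ^ 4) with ((x ^ 2) ^ 2) by ring. apply pow2_ge_0. Qed.

Lemma continuous_lemn_integrand (x : R) : continuous lemn_integrand x.
Proof.
  apply continuous_of_ex_derive. unfold lemn_integrand.
  pose proof (pow4_ge_0 x).
  auto_derive. split; [lra|]. split; [|exact I].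
  apply Rgt_not_eq, sqrt_lt_R0. simpl in *; lra.
Qed.

Lemma is_derive_lemn_primitive (v : R) :
  is_derive lemn_primitive v (lemn_integrand v).
Proof. apply is_derive_primitive, continuous_lemn_integrand. Qed.

Lemma lemn_primitive_0 : lemn_primitive 0 = 0.
Proof. apply (@RInt_point R_CompleteNormedModule). Qed.

Lemma continuous_lemn_primitive (v : R) : continuous lemn_primitive v.
Proof.
  apply continuous_of_ex_derive.
  exists (lemn_integrand v). apply is_derive_lemn_primitive.
Qed.

(** An antiderivative of [b^2 / sqrt (1 - b^4)] that stays continuous at the
    singular end [b = 1].  It comes from the substitution
    [b^2 = 2 v^2 / (1 + v^4)], that is [v = b / sqrt (1 + w)] with
    [w = sqrt (1 - b^4)], followed by an integration by parts that produces the
    algebraic term. *)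
Definition lemn_antiderivative (b : R) : R :=
  b ^ 3 / (1 + sqrt (1 - b ^ 4))
  - sqrt 2 * lemn_primitive (b / sqrt (1 + sqrt (1 - b ^ 4))).

Lemma is_derive_lemn_antiderivative (b : R) : -1 < b < 1 ->
  is_derive lemn_antiderivative b (b ^ 2 / sqrt (1 - b ^ 4)).
Proof.
  intros Hb. unfold lemn_antiderivative.
  assert (Hb2 : 0 <= b ^ 2 < 1) by nra.
  assert (Hb4 : 0 < 1 - b ^ 4) by (replace (b ^ 4) with (b ^ 2 * b ^ 2) by ring;
    set (q := b ^ 2) in *; nra).
  pose proof (sqrt_lt_R0 _ Hb4) as Hw.
  pose proof (sqrt_sqrt (1 - b ^ 4) (Rlt_le _ _ Hb4)) as Hww.
  assert (Hc : 0 < sqrt (1 + sqrt (1 - b ^ 4))) by (apply sqrt_lt_R0; lra).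
  assert (Hcc := sqrt_sqrt (1 + sqrt (1 - b ^ 4)) ltac:(lra)).
  assert (H2 : 0 < sqrt 2) by (apply sqrt_lt_R0; lra).
  assert (Dv : is_derive (fun b => b / sqrt (1 + sqrt (1 - b ^ 4))) b
    (/ (sqrt (1 - b ^ 4) * sqrt (1 + sqrt (1 - b ^ 4))))).
  { auto_derive.
    - change (b * (b * (b * (b * 1)))) with (b ^ 4). fold (Rminus 1 (b ^ 4)). nz.
    - change (b * (b * (b * (b * 1)))) with (b ^ 4).
      replace (1 + - b ^ 4) with (1 - b ^ 4) by ring.
      set (w := sqrt (1 - b ^ 4)) in *. set (c := sqrt (1 + w)) in *.
      transitivity ((w * (c * c) + b ^ 4) / (w * c ^ 3)).
      + field; nz.
      + rewrite Hcc. replace (b ^ 4) with (1 - w * w) by lra.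
        replace (w * (1 + w) + (1 - w * w)) with (c * c) by lra.
        field; nz. }
  assert (Du : is_derive (fun b => b ^ 3 / (1 + sqrt (1 - b ^ 4))) b
    (b ^ 2 * (2 + sqrt (1 - b ^ 4))
       / (sqrt (1 - b ^ 4) * (1 + sqrt (1 - b ^ 4))))).
  { auto_derive.
    - change (b * (b * (b * (b * 1)))) with (b ^ 4). fold (Rminus 1 (b ^ 4)). nz.
    - change (b * (b * (b * (b * 1)))) with (b ^ 4).
      replace (1 + - b ^ 4) with (1 - b ^ 4) by ring.
      set (w := sqrt (1 - b ^ 4)) in *.
      transitivity ((3 * b ^ 2 * w * (1 + w) + 2 * b ^ 2 * b ^ 4) / (w * (1 + w) ^ 2)).
      + field; nz.
      + replace (b ^ 4) with (1 - w * w) by lra. field; nz. }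
  assert (Hk : lemn_integrand (b / sqrt (1 + sqrt (1 - b ^ 4)))
               = b ^ 2 / (sqrt 2 * sqrt (1 + sqrt (1 - b ^ 4)))).
  { unfold lemn_integrand.
    replace (1 + (b / sqrt (1 + sqrt (1 - b ^ 4))) ^ 4) with
      (2 / (1 + sqrt (1 - b ^ 4))).
    - rewrite sqrt_div by lra.
      set (c := sqrt (1 + sqrt (1 - b ^ 4))) in *. field; nz.
    - unfold Rdiv at 2. rewrite Rpow_mult_distr, pow_inv.
      replace (sqrt (1 + sqrt (1 - b ^ 4)) ^ 4) with
        ((1 + sqrt (1 - b ^ 4)) ^ 2) by (rewrite <- Hcc at 1; ring).
      set (w := sqrt (1 - b ^ 4)) in *.
      replace (b ^ 4) with (1 - w * w) by lra. field; nz. }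
  pose proof (is_derive_comp lemn_primitive _ b _ _
    (is_derive_lemn_primitive ((fun b => b / sqrt (1 + sqrt (1 - b ^ 4))) b)) Dv) as Dk.
  pose proof (is_derive_minus _ _ _ _ _ Du (is_derive_scal _ _ (sqrt 2) _ Dk)) as D.
  cbv beta in D.
  eapply is_derive_eq; [|exact D].
  rewrite Hk. unfold minus, plus, opp, scal, mult; cbn -[pow sqrt]; unfold mult; cbn -[pow sqrt].
  change (b * (b * (b * (b * 1)))) with (b ^ 4). change (b * (b * 1)) with (b ^ 2).
  set (w := sqrt (1 - b ^ 4)) in *. set (c := sqrt (1 + w)) in *.
  transitivity (b ^ 2 * (2 + w) / (w * (1 + w)) - b ^ 2 / (w * (c * c))).
  - field; nz.
  - rewrite Hcc. field; nz.
Qed.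

Lemma second_lemniscate_constant_eq : second_lemniscate_constant = lemn_B.
Proof.
  apply (@is_RInt_gen_unique R_CompleteNormedModule);
    [apply Proper_StrongProper, at_point_filter|apply Proper_StrongProper, at_left_proper_filter|].
  replace lemn_B with (lemn_antiderivative 1 - lemn_antiderivative 0).
  2:{ unfold lemn_antiderivative, lemn_B.
      replace (1 - 1 ^ 4) with 0 by ring. rewrite sqrt_0.
      replace (1 / sqrt (1 + 0)) with 1
        by (rewrite Rplus_0_r, sqrt_1; field).
      replace (0 / _) with 0 by (unfold Rdiv; ring).
      rewrite lemn_primitive_0. field.
      rewrite pow_ne_zero by lia.
      rewrite Rminus_0_r, sqrt_1. lra. }
  apply (is_RInt_gen_primitive _ lemn_antiderivative);
    [apply at_point_filter|apply at_left_proper_filter| | |].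
  - apply (Filter_prod _ _ _ (fun a => a = 0) (fun b => 0 < b < 1)).
    + reflexivity.
    + apply at_left_1_unit.
    + intros a b -> Hb x. simpl. rewrite Rmin_left, Rmax_right by lra. intros Hx.
      split; [apply is_derive_lemn_antiderivative; lra|].
      apply continuous_of_ex_derive.
      assert (0 < 1 - x ^ 4).
      { assert (0 <= x ^ 2 < 1) by nra.
        replace (x ^ 4) with (x ^ 2 * x ^ 2) by ring. set (q := x ^ 2) in *. nra. }
      auto_derive. change (x * (x * (x * (x * 1)))) with (x ^ 4). fold (Rminus 1 (x ^ 4)).
      nz. now apply Rgt_not_eq, sqrt_lt_R0.
  - intros P HP. unfold filtermap, at_point. now apply locally_singleton.
  - apply filterlim_at_left_continuous.
    unfold lemn_antiderivative.
    assert (Hw : continuous (fun x => sqrt (1 - x ^ 4)) 1).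
    { apply continuous_comp; [|apply continuous_sqrt].
      apply continuous_of_ex_derive. now auto_derive. }
    assert (Hw1 : 1 + sqrt (1 - 1 ^ 4) = 1)
      by (replace (1 - 1 ^ 4) with 0 by ring; rewrite sqrt_0; ring).
    assert (Hw' : continuous (fun x => 1 + sqrt (1 - x ^ 4)) 1)
      by (apply (@continuous_plus R_UniformSpace R_AbsRing R_NormedModule); [apply continuous_const|exact Hw]).
    apply (@continuous_minus R_UniformSpace R_AbsRing R_NormedModule).
    + apply (@continuous_mult R_UniformSpace R_AbsRing).
      * apply continuous_of_ex_derive. now auto_derive.
      * apply continuous_Rinv_comp; [exact Hw'|]. rewrite Hw1. lra.
    + apply (@continuous_mult R_UniformSpace R_AbsRing); [apply continuous_const|].
      apply continuous_comp; [|apply continuous_lemn_primitive].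
      apply (@continuous_mult R_UniformSpace R_AbsRing); [apply continuous_id|].
      apply continuous_Rinv_comp.
      * apply continuous_comp; [exact Hw'|apply continuous_sqrt].
      * rewrite Hw1, sqrt_1. lra.
Qed.

(** * The defect [sqrt J - I p] for large slopes *)

(** The integral in the numerator of the parametrization of the abscissa by the
    slope. *)
Definition slope_integral (p : R) : R :=
  RInt (fun t => / (2 * sqrt (sqrt (1 + t ^ 2)))) 0 p.

Lemma sqrt_1_plus_sqr_ge_1 (t : R) : 1 <= sqrt (1 + t ^ 2).
Proof.
  rewrite <- sqrt_1 at 1. apply sqrt_le_1_alt. pose proof (pow2_ge_0 t). lra.
Qed.

Lemma is_derive_slope_integral (p : R) :
  is_derive slope_integral p (/ (2 * sqrt (sqrt (1 + p ^ 2)))).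
Proof.
  apply (is_derive_primitive (fun t => / (2 * sqrt (sqrt (1 + t ^ 2))))).
  intros z. apply continuous_of_ex_derive.
  pose proof (sqrt_1_plus_sqr_ge_1 z) as Hz. pose proof (pow2_ge_0 z) as Hz2.
  assert (0 < sqrt (sqrt (1 + z ^ 2))) by (apply sqrt_lt_R0; lra).
  auto_derive. change (z * (z * 1)) with (z ^ 2). nz.
Qed.

(** Both sides have the same derivative and the value [1] at [p = 0].  The
    variable [v = sqrt (J - p)], with [J = sqrt (1 + p^2)], makes
    [1 + v^4 = 2 J v^2] a square up to the factor [2 J], which is why the
    quartic root of [1 + p^2] turns into the integrand of [lemn_primitive]. *)
Lemma slope_defect_eq (p : R) : 0 <= p ->
  sqrt (sqrt (1 + p ^ 2)) - slope_integral p
  = lemn_B + sqrt 2 * lemn_primitive (sqrt (sqrt (1 + p ^ 2) - p)).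
Proof.
  intros Hp.
  set (f := fun p => sqrt (sqrt (1 + p ^ 2)) - slope_integral p
                     - sqrt 2 * lemn_primitive (sqrt (sqrt (1 + p ^ 2) - p))).
  assert (Hf : forall p : R, is_derive f p 0).
  { intros t. unfold f.
    pose proof (sqrt_1_plus_sqr_ge_1 t) as HJ.
    pose proof (pow2_ge_0 t) as Ht.
    pose proof (sqrt_sqrt (1 + t ^ 2) ltac:(lra)) as HJJ.
    assert (HJt : 0 < sqrt (1 + t ^ 2) - t) by nra.
    assert (Hv : 0 < sqrt (sqrt (1 + t ^ 2) - t)) by now apply sqrt_lt_R0.
    pose proof (sqrt_sqrt _ (Rlt_le _ _ HJt)) as Hvv.
    assert (Hj : 0 < sqrt (sqrt (1 + t ^ 2))) by (apply sqrt_lt_R0; lra).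
    pose proof (sqrt_sqrt (sqrt (1 + t ^ 2)) ltac:(lra)) as Hjj.
    assert (H2 : 0 < sqrt 2) by (apply sqrt_lt_R0; lra).
    pose proof (sqrt_sqrt 2 ltac:(lra)) as H22.
    assert (D1 : is_derive (fun p => sqrt (sqrt (1 + p ^ 2))) t
      (t / (2 * sqrt (1 + t ^ 2) * sqrt (sqrt (1 + t ^ 2))))).
    { auto_derive; change (t * (t * 1)) with (t ^ 2); [nz|]. field; nz. }
    assert (D2 : is_derive (fun p => sqrt (sqrt (1 + p ^ 2) - p)) t
      (- sqrt (sqrt (1 + t ^ 2) - t) / (2 * sqrt (1 + t ^ 2)))).
    { auto_derive; change (t * (t * 1)) with (t ^ 2);
        fold (Rminus (sqrt (1 + t ^ 2)) t); [nz|].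
      set (v := sqrt (sqrt (1 + t ^ 2) - t)) in *.
      set (J := sqrt (1 + t ^ 2)) in *.
      transitivity (- (v * v) / (2 * J * v)).
      - rewrite Hvv. field; nz.
      - field; nz. }
    assert (Hk : lemn_integrand (sqrt (sqrt (1 + t ^ 2) - t))
      = sqrt (sqrt (1 + t ^ 2) - t) / (sqrt 2 * sqrt (sqrt (1 + t ^ 2)))).
    { unfold lemn_integrand.
      replace (1 + sqrt (sqrt (1 + t ^ 2) - t) ^ 4) with
        (2 * sqrt (1 + t ^ 2) * (sqrt (1 + t ^ 2) - t)).
      - rewrite sqrt_mult, sqrt_mult by lra. field; nz.
      - set (v := sqrt (sqrt (1 + t ^ 2) - t)) in *.
        set (J := sqrt (1 + t ^ 2)) in *.
        replace (v ^ 4) with ((v * v) * (v * v)) by ring. rewrite Hvv. nra. }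
    pose proof (is_derive_comp lemn_primitive _ t _ _
      (is_derive_lemn_primitive ((fun p => sqrt (sqrt (1 + p ^ 2) - p)) t)) D2) as D3.
    pose proof (is_derive_minus _ _ _ _ _
      (is_derive_minus _ _ _ _ _ D1 (is_derive_slope_integral t))
      (is_derive_scal _ _ (sqrt 2) _ D3)) as D.
    cbv beta in D. eapply is_derive_eq; [|exact D].
    rewrite Hk. unfold minus, plus, opp, scal, mult; cbn -[pow sqrt];
      unfold mult; cbn -[pow sqrt].
    set (v := sqrt (sqrt (1 + t ^ 2) - t)) in *.
    set (j := sqrt (sqrt (1 + t ^ 2))) in *. set (J := sqrt (1 + t ^ 2)) in *.
    transitivity ((t - J + v * v) / (2 * J * j)).
    - field; nz.
    - rewrite Hvv. field; nz. }
  assert (H0 : f p = f 0).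
  { destruct (Req_dec p 0) as [->|Hp0]; [reflexivity|].
    apply constant_of_derive_0; [lra|intros; apply Hf|].
    intros x _. apply continuity_pt_filterlim.
    apply (continuous_of_ex_derive f x).
    exists 0. apply Hf. }
  assert (E0 : f 0 = lemn_B).
  { unfold f, lemn_B, slope_integral. rewrite (@RInt_point R_CompleteNormedModule).
    replace (1 + 0 ^ 2) with 1 by ring. rewrite !sqrt_1.
    replace (1 - 0) with 1 by ring. rewrite sqrt_1. unfold zero; simpl. ring. }
  unfold f in *. lra.
Qed.

Lemma slope_defect_lim :
  filterlim (fun p => sqrt (sqrt (1 + p ^ 2)) - slope_integral p)
    (Rbar_locally p_infty) (locally lemn_B).
Proof.
  apply (filterlim_ext_loc
    (fun p => lemn_B + sqrt 2 * lemn_primitive (sqrt (sqrt (1 + p ^ 2) - p)))).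
  { exists 0. intros p Hp. symmetry. apply slope_defect_eq. lra. }
  assert (HJ : filterlim (fun p => sqrt (1 + p ^ 2) - p)
                 (Rbar_locally p_infty) (locally 0)).
  { apply (filterlim_locally (fun p => sqrt (1 + p ^ 2) - p)). intros eps.
    pose proof (cond_pos eps) as He. exists (/ eps). intros p Hp.
    assert (Hp0 : 0 < / eps) by now apply Rinv_0_lt_compat.
    assert (Hpe : 1 < p * eps).
    { apply (Rmult_lt_compat_r eps) in Hp; [|exact He].
      rewrite Rinv_l in Hp; lra. }
    unfold ball; simpl; unfold AbsRing_ball, abs, minus, plus, opp; simpl.
    change (p * (p * 1)) with (p ^ 2).
    pose proof (pow2_ge_0 p).
    pose proof (sqrt_sqrt (1 + p ^ 2) ltac:(lra)).
    pose proof (sqrt_1_plus_sqr_ge_1 p).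
    (* Here [(J - p) (J + p) = 1] with [J + p > 1 / eps]. *)
    apply Rabs_def1; nra. }
  set (h := fun u => lemn_B + sqrt 2 * lemn_primitive (sqrt u)).
  apply (filterlim_comp _ _ _ (fun p => sqrt (1 + p ^ 2) - p) h _ (locally 0));
    [exact HJ|].
  replace lemn_B with (h 0)
    by (unfold h; rewrite sqrt_0, lemn_primitive_0; ring).
  change (continuous h 0). unfold h.
  apply (@continuous_plus R_UniformSpace R_AbsRing R_NormedModule);
    [apply continuous_const|].
  apply (@continuous_mult R_UniformSpace R_AbsRing); [apply continuous_const|].
  apply continuous_comp; [apply continuous_sqrt|apply continuous_lemn_primitive].
Qed.

(** * Numerical value of the constant *)

(** On [[0, 1]] this is at most [1/2], while [x^4] itself reaches [1]: moments in
    this variable decay geometrically. *)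
Definition lemn_ratio (x : R) : R := x ^ 4 / (1 + x ^ 4).
Definition lemn_moment (n : nat) : R :=
  sqrt 2 * RInt (fun x => lemn_integrand x * lemn_ratio x ^ n) 0 1.

Lemma is_derive_lemn_ratio (x : R) :
  is_derive lemn_ratio x (4 * x ^ 3 / (1 + x ^ 4) ^ 2).
Proof.
  unfold lemn_ratio. pose proof (pow4_ge_0 x) as Hx.
  auto_derive; change (x * (x * (x * (x * 1)))) with (x ^ 4); [nz|]. field; nz.
Qed.

Lemma continuous_lemn_moment_integrand (n : nat) (x : R) :
  continuous (fun x => lemn_integrand x * lemn_ratio x ^ n) x.
Proof.
  apply (@continuous_mult R_UniformSpace R_AbsRing); [apply continuous_lemn_integrand|].
  apply (continuous_comp lemn_ratio (fun u => u ^ n)).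
  - apply continuous_of_ex_derive.
    eexists. apply is_derive_lemn_ratio.
  - apply continuous_of_ex_derive. now auto_derive.
Qed.

Lemma ex_RInt_lemn_moment (n : nat) (a b : R) :
  ex_RInt (fun x => lemn_integrand x * lemn_ratio x ^ n) a b.
Proof.
  apply (@ex_RInt_continuous R_CompleteNormedModule). intros z _.
  apply continuous_lemn_moment_integrand.
Qed.

(** Integrating by parts in powers of [lemn_ratio] relates two consecutive
    moments; the boundary term at [1] is [2^(-n) / sqrt 2]. *)
Lemma is_derive_lemn_moment (n : nat) (x : R) :
  is_derive (fun x => x ^ 3 / sqrt (1 + x ^ 4) * lemn_ratio x ^ n) x
    ((4 * INR n + 3) * (lemn_integrand x * lemn_ratio x ^ n)
     - (4 * INR n + 2) * (lemn_integrand x * lemn_ratio x ^ S n)).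
Proof.
  pose proof (pow4_ge_0 x) as Hx.
  assert (Hr : 0 < sqrt (1 + x ^ 4)) by (apply sqrt_lt_R0; lra).
  pose proof (sqrt_sqrt (1 + x ^ 4) ltac:(lra)) as Hrr.
  assert (D1 : is_derive (fun x => x ^ 3 / sqrt (1 + x ^ 4)) x
     (lemn_integrand x * (3 - 2 * lemn_ratio x))).
  { unfold lemn_integrand, lemn_ratio.
    auto_derive; change (x * (x * (x * (x * 1)))) with (x ^ 4); [nz|].
    set (r := sqrt (1 + x ^ 4)) in *.
    transitivity ((3 * x ^ 2 * (r * r) - 2 * x ^ 2 * x ^ 4) / (r * (r * r))).
    - field; nz.
    - rewrite Hrr. field; nz. }
  assert (D2 : is_derive (fun x => lemn_ratio x ^ n) x
     (INR n * (4 * x ^ 3 / (1 + x ^ 4) ^ 2) * lemn_ratio x ^ pred n)).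
  { apply (is_derive_pow lemn_ratio n x). apply is_derive_lemn_ratio. }
  pose proof (is_derive_mult _ _ _ _ _ D1 D2 Rmult_comm) as D.
  cbv beta in D. eapply is_derive_eq; [|exact D].
  unfold plus, mult; cbn -[pow sqrt INR].
  assert (Hk : x ^ 3 / sqrt (1 + x ^ 4) * (4 * x ^ 3 / (1 + x ^ 4) ^ 2)
     = 4 * lemn_integrand x * (1 - lemn_ratio x) * lemn_ratio x).
  { unfold lemn_integrand, lemn_ratio. field; nz. }
  destruct n as [|m].
  - simpl. ring.
  - cbn [pred].
    transitivity (lemn_integrand x * (3 - 2 * lemn_ratio x) * lemn_ratio x ^ S m
      + INR (S m) * lemn_ratio x ^ m * (x ^ 3 / sqrt (1 + x ^ 4) * (4 * x ^ 3 / (1 + x ^ 4) ^ 2))).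
    + ring.
    + rewrite Hk. cbn [pow]. ring.
Qed.

Lemma lemn_moment_rec (n : nat) :
  (4 * INR n + 3) * lemn_moment n = / 2 ^ n + (4 * INR n + 2) * lemn_moment (S n).
Proof.
  assert (H2 : 0 < sqrt 2) by (apply sqrt_lt_R0; lra).
  pose proof (sqrt_sqrt 2 ltac:(lra)) as H22.
  assert (HI := is_RInt_unique _ _ _ _
    (is_RInt_derive (V := R_CompleteNormedModule) _ _ 0 1
       (fun x _ => is_derive_lemn_moment n x)
       (fun x _ => continuous_minus _ _ _
           (continuous_mult _ _ _ (continuous_const _ _) (continuous_lemn_moment_integrand n x))
           (continuous_mult _ _ _ (continuous_const _ _) (continuous_lemn_moment_integrand (S n) x))))).
  rewrite (@RInt_minus R_CompleteNormedModule) in HI.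
  2,3: apply (@ex_RInt_scal R_CompleteNormedModule), ex_RInt_lemn_moment.
  rewrite !(@RInt_scal R_CompleteNormedModule) in HI by apply ex_RInt_lemn_moment.
  unfold lemn_moment.
  set (A := RInt (fun x => lemn_integrand x * lemn_ratio x ^ n) 0 1) in *.
  set (B := RInt (fun x => lemn_integrand x * lemn_ratio x ^ S n) 0 1) in *.
  change ((4 * INR n + 3) * A - (4 * INR n + 2) * B
    = 1 ^ 3 / sqrt (1 + 1 ^ 4) * lemn_ratio 1 ^ n
      - 0 ^ 3 / sqrt (1 + 0 ^ 4) * lemn_ratio 0 ^ n) in HI.
  clearbody A B.
  assert (E1 : lemn_ratio 1 = / 2) by (unfold lemn_ratio; field).
  rewrite E1, pow_inv in HI.
  replace (1 + 1 ^ 4) with 2 in HI by ring.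
  replace (0 ^ 3) with 0 in HI by ring. unfold Rdiv in HI.
  rewrite !Rmult_0_l, pow1, Rmult_1_l in HI.
  assert (E : sqrt 2 * (/ sqrt 2 * / 2 ^ n) = / 2 ^ n).
  { field. split; [apply pow_nonzero; lra|lra]. }
  rewrite <- E.
  transitivity (sqrt 2 * ((4 * INR n + 3) * A)); [ring|].
  replace ((4 * INR n + 3) * A) with (/ sqrt 2 * / 2 ^ n + (4 * INR n + 2) * B) by lra.
  ring.
Qed.

(** This closes the recurrence: the moment left over after [n] steps is of the
    size of [2^(-n)], because [lemn_ratio] is at most [1/2]. *)
Lemma lemn_moment_bounds (n : nat) : 0 <= lemn_moment n <= / 2 ^ n / 2.
Proof.
  assert (H2 : 0 < sqrt 2) by (apply sqrt_lt_R0; lra).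
  pose proof (sqrt_sqrt 2 ltac:(lra)) as H22.
  assert (Hq : forall x, 0 <= x <= 1 -> 0 <= lemn_ratio x <= / 2).
  { intros x Hx. assert (0 <= x ^ 4 <= 1).
    { split; [apply pow4_ge_0|]. rewrite <- (pow1 4). apply pow_incr; lra. }
    unfold lemn_ratio. split.
    - apply Rmult_le_pos; [lra|]. left. apply Rinv_0_lt_compat. lra.
    - apply (Rmult_le_reg_r (1 + x ^ 4)); [lra|]. unfold Rdiv.
      rewrite Rmult_assoc, Rinv_l; lra. }
  assert (Hk : forall x, 0 <= lemn_integrand x <= x ^ 2).
  { intros x. pose proof (pow4_ge_0 x). pose proof (pow2_ge_0 x).
    unfold lemn_integrand.
    assert (1 <= sqrt (1 + x ^ 4))
      by (rewrite <- sqrt_1 at 1; apply sqrt_le_1_alt; lra).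
    assert (0 < / sqrt (1 + x ^ 4)) by (apply Rinv_0_lt_compat; lra).
    assert (/ sqrt (1 + x ^ 4) <= 1) by (apply Rle_trans with (/ 1); [apply Rinv_le_contravar|]; lra).
    unfold Rdiv. split; nra. }
  assert (Hp : 0 < / 2 ^ n) by (apply Rinv_0_lt_compat, pow_lt; lra).
  assert (Hi : is_RInt (fun x => / 2 ^ n * x ^ 2) 0 1 (/ 2 ^ n * / 3)).
  { eapply (eq_ind _ (fun l => is_RInt _ 0 1 l)).
    - apply (@is_RInt_derive R_CompleteNormedModule (fun x => / 2 ^ n * (x ^ 3 / 3))).
      + intros x _. auto_derive; [exact I|]. field. apply pow_nonzero; lra.
      + intros x _. apply continuous_of_ex_derive. now auto_derive.
    - unfold minus, plus, opp; simpl. field. apply pow_nonzero; lra. }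
  unfold lemn_moment. split.
  - apply Rmult_le_pos; [lra|]. apply RInt_ge_0; [lra|apply ex_RInt_lemn_moment|].
    intros x Hx. apply Rmult_le_pos; [apply Hk|apply pow_le, Hq; lra].
  - assert (RInt (fun x => lemn_integrand x * lemn_ratio x ^ n) 0 1 <= / 2 ^ n * / 3).
    { rewrite <- (is_RInt_unique _ _ _ _ Hi).
      apply RInt_le; [lra|apply ex_RInt_lemn_moment|eexists; exact Hi|].
      intros x Hx. rewrite Rmult_comm.
      apply Rmult_le_compat; try apply Hk; [apply pow_le, Hq; lra|].
      rewrite <- pow_inv. apply pow_incr, Hq. lra. }
    assert (sqrt 2 < 3 / 2) by nra.
    set (I := RInt _ 0 1) in *. nra.
Qed.

Lemma lemn_B_moment : lemn_B = 1 - lemn_moment 0.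
Proof.
  unfold lemn_B, lemn_moment, lemn_primitive. do 2 f_equal.
  apply RInt_ext. intros x _. simpl. ring.
Qed.

(** The recurrence contracts errors, since [(4 n + 2) / (4 n + 3) < 1], and the
    thirtieth moment is at most [2^(-31)], so the first moment is known to about
    [1.4 * 10^(-10)].  The square is close to [0.3588850055], at distance
    [7.2 * 10^(-10)] from the decimal in the statement. *)
Lemma lemn_B_sqr_approx : Rabs (lemn_B ^ 2 - 0.3588850048) < 1 / 10 ^ 9.
Proof.
  rewrite lemn_B_moment.
  assert (H : 0.4009298826 < lemn_moment 0 < 0.4009298828).
  { Ltac unfold_moments n :=
      match n with
      | O => idtac
      | S ?m => 
        unfold_moments m;
        let H := fresh "H" in
        pose proof (lemn_moment_rec m) as H;
        let k := eval compute in (Z.of_nat m) in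
        rewrite INR_IZR_INZ in H; change (Z.of_nat m) with k in H;
        simpl pow in H
      end.
    unfold_moments 30%nat.
    pose proof (lemn_moment_bounds 30) as Hb. simpl pow in Hb.
    (* Thirty linear equations and one two-sided bound: the unknown first moment
       lies in an interval of length [1.4 * 10^(-10)]. *)
    lra. }
  replace (1 / 10 ^ 9) with (1 / 1000000000) by (simpl; lra).
  apply Rabs_def1; nra.
Qed.

(** * Squares of integrals in polar form, and the Gaussian moment *)

(** The square of [RInt phi 0 t] is the integral of [phi a * phi b] over the
    square of side [t].  By symmetry it is twice the integral over the triangle
    [b <= a], which the rays [b = a v] with [0 <= v <= 1] sweep: in the
    coordinates [(a, v)] the density is [2 a phi a phi (a v)], and [H] is its
    antiderivative along each ray.  Comparing
    derivatives in [t] avoids double integrals altogether. *)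
Lemma primitive_sqr (phi : R -> R) (H : R -> R -> R) (t : R) :
  (forall x : R, continuous phi x) ->
  (forall u v : R, is_derive (fun u => H u v) u (2 * u * phi u * phi (u * v))) ->
  (forall u v : R, continuous (H u) v) ->
  (forall v, H 0 v = 0) ->
  0 <= t -> RInt phi 0 t ^ 2 = RInt (H t) 0 1.
Proof.
  intros Hphi Hd Hc H0 Ht.
  set (D := fun t => RInt phi 0 t ^ 2 - RInt (H t) 0 1).
  assert (HD : forall u : R, is_derive D u 0).
  { intros u. unfold D.
    assert (D1 := is_derive_primitive phi 0 u Hphi).
    assert (D2 := is_derive_pow (fun t => RInt phi 0 t) 2 u _ D1).
    assert (D3 : is_derive (fun t => RInt (H t) 0 1) u
                  (RInt (fun v => Derive (fun u => H u v) u) 0 1)).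
    { apply is_derive_RInt_param.
      - apply filter_forall. intros z v _. eexists. apply Hd.
      - intros v _.
        apply (continuity_2d_pt_ext (fun u v => 2 * u * phi u * phi (u * v))).
        { intros a b. symmetry. apply is_derive_unique, Hd. }
        apply continuity_2d_pt_mult; [apply continuity_2d_pt_mult|].
        + apply continuity_2d_pt_mult;
            [apply continuity_2d_pt_const|apply continuity_2d_pt_id1].
        + apply (continuity_1d_2d_pt_comp phi (fun u v => u));
            [apply continuity_pt_filterlim, Hphi|apply continuity_2d_pt_id1].
        + apply (continuity_1d_2d_pt_comp phi (fun u v => u * v));
            [apply continuity_pt_filterlim, Hphi|].
          apply continuity_2d_pt_mult;
            [apply continuity_2d_pt_id1|apply continuity_2d_pt_id2].
      - apply filter_forall. intros z.
        apply (@ex_RInt_continuous R_CompleteNormedModule). intros v _. apply Hc. }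
    pose proof (is_derive_minus _ _ _ _ _ D2 D3) as D4. cbv beta in D4.
    eapply is_derive_eq; [|exact D4].
    (* Substituting [x = u v] turns the integral over [[0, 1]] back into the
       primitive at [u]. *)
    rewrite (RInt_ext (fun v => Derive (fun u => H u v) u)
               (fun v => scal (2 * phi u) (scal u (phi (u * v + 0))))).
    2:{ intros v _. etransitivity; [apply is_derive_unique, Hd|]. rewrite Rplus_0_r.
        unfold scal; simpl; unfold mult; simpl. ring. }
    assert (Hs : ex_RInt (fun v => scal u (phi (u * v + 0))) 0 1).
    { apply (@ex_RInt_comp_lin R_NormedModule).
      apply (@ex_RInt_continuous R_CompleteNormedModule). intros z _. apply Hphi. }
    rewrite (@RInt_scal R_CompleteNormedModule) by exact Hs.
    rewrite (@RInt_comp_lin R_CompleteNormedModule) by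
      (apply (@ex_RInt_continuous R_CompleteNormedModule); intros z _; apply Hphi).
    replace (u * 0 + 0) with 0 by ring. replace (u * 1 + 0) with u by ring.
    set (G := RInt phi 0 u). clearbody G.
    change (INR 2 * phi u * G ^ 1 - (2 * phi u) * G = 0). simpl. ring. }
  assert (E : D t = D 0).
  { destruct (Req_dec t 0) as [->|Ht0]; [reflexivity|].
    apply constant_of_derive_0; [lra|intros; apply HD|].
    intros x _. apply continuity_pt_filterlim.
    apply (continuous_of_ex_derive D x).
    exists 0. apply HD. }
  assert (D 0 = 0).
  { unfold D. rewrite (@RInt_point R_CompleteNormedModule).
    rewrite (RInt_ext _ (fun _ => 0)) by (intros; apply H0).
    rewrite (@RInt_const R_CompleteNormedModule).
    unfold zero, scal; simpl; unfold mult; simpl. ring. }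
  unfold D in *. lra.
Qed.

Lemma filterlim_of_sqr_squeeze (G e : R -> R) (c l : R) :
  (forall t, 0 <= t -> 0 <= G t) ->
  (forall t, 0 <= t -> c * e t <= G t ^ 2 <= c * l) ->
  filterlim e (Rbar_locally p_infty) (locally l) ->
  filterlim G (Rbar_locally p_infty) (locally (sqrt (c * l))).
Proof.
  intros Hpos Hsq He.
  apply (filterlim_ext_loc (fun t => sqrt (G t ^ 2))).
  { exists 0. intros t Ht. apply sqrt_pow2, Hpos. lra. }
  apply (filterlim_comp _ _ _ (fun t => G t ^ 2) sqrt _ (locally (c * l)));
    [|apply continuous_sqrt].
  apply (filterlim_le_le (fun t => c * e t) _ (fun _ => c * l) (c * l)).
  - exists 0. intros t Ht. apply Hsq. lra.
  - apply (filterlim_comp _ _ _ e (fun u => c * u) _ (locally l)); [exact He|].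
    apply (@filterlim_scal_r R_AbsRing R_NormedModule).
  - apply filterlim_const.
Qed.

Definition gauss_primitive (z : R) : R := RInt (fun x => exp (- x ^ 2)) 0 z.

Lemma continuous_gauss (x : R) : continuous (fun x => exp (- x ^ 2)) x.
Proof. apply continuous_of_ex_derive. now auto_derive. Qed.

Lemma exp_neg_sqr_lim :
  filterlim (fun t => exp (- t ^ 2)) (Rbar_locally p_infty) (locally 0).
Proof.
  apply (filterlim_comp _ _ _ (fun t => - t ^ 2) exp _ (Rbar_locally m_infty)).
  - intros P [M HM]. exists (Rmax 1 (- M)). intros t Ht. apply HM.
    pose proof (Rmax_l 1 (- M)). pose proof (Rmax_r 1 (- M)). nra.
  - apply is_lim_exp_m.
Qed.

(** In [primitive_sqr] the radial integral of [exp (- u^2 (1 + v^2))] is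
    elementary, and the angular weight [1 / (1 + v^2)] has integral
    [atan 1 = PI / 4]. *)
Lemma gauss_primitive_lim :
  filterlim gauss_primitive (Rbar_locally p_infty) (locally (sqrt (PI / 4 * 1))).
Proof.
  assert (Hint : is_RInt (fun v => / (1 + v ^ 2)) 0 1 (PI / 4)).
  { replace (PI / 4) with (minus (atan 1) (atan 0))
      by (rewrite atan_0, atan_1; unfold minus, plus, opp; simpl; ring).
    apply (@is_RInt_derive R_CompleteNormedModule).
    - intros x _. apply is_derive_Reals, derivable_pt_lim_atan.
    - intros x _. apply continuous_of_ex_derive.
      pose proof (pow2_ge_0 x). auto_derive. change (x * (x * 1)) with (x ^ 2). nz. }
  apply (filterlim_of_sqr_squeeze _ (fun t => 1 - exp (- t ^ 2))).
  - intros t Ht. apply RInt_ge_0; [exact Ht| |intros; apply Rlt_le, exp_pos].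
    apply (@ex_RInt_continuous R_CompleteNormedModule). intros z _. apply continuous_gauss.
  - intros t Ht.
    assert (Hc : forall u v, continuous (fun v => (1 - exp (- (u ^ 2 * (1 + v ^ 2)))) / (1 + v ^ 2)) v).
    { intros u v. apply continuous_of_ex_derive.
      pose proof (pow2_ge_0 v). auto_derive. change (v * (v * 1)) with (v ^ 2). nz. }
    unfold gauss_primitive.
    rewrite (primitive_sqr _ (fun u v => (1 - exp (- (u ^ 2 * (1 + v ^ 2)))) / (1 + v ^ 2))).
    + assert (Hex : ex_RInt (fun v => (1 - exp (- (t ^ 2 * (1 + v ^ 2)))) / (1 + v ^ 2)) 0 1)
        by (apply (@ex_RInt_continuous R_CompleteNormedModule); intros z _; apply Hc).
      assert (Hw : forall v, 0 < / (1 + v ^ 2))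
        by (intros v; apply Rinv_0_lt_compat; pose proof (pow2_ge_0 v); lra).
      assert (Hint' : is_RInt (fun v => (1 - exp (- t ^ 2)) * / (1 + v ^ 2)) 0 1
                        ((1 - exp (- t ^ 2)) * (PI / 4)))
        by exact (is_RInt_scal _ 0 1 (1 - exp (- t ^ 2)) _ Hint).
      split.
      * apply Rle_trans with ((1 - exp (- t ^ 2)) * (PI / 4)); [lra|].
        rewrite <- (is_RInt_unique _ _ _ _ Hint').
        apply RInt_le; [lra|eexists; exact Hint'|exact Hex|].
        intros v Hv.
        apply Rmult_le_compat_r; [apply Rlt_le, Hw|].
        apply Rplus_le_compat_l, Ropp_le_contravar.
        destruct (Req_dec (v * t) 0) as [E|E].
        -- apply Req_le. f_equal. nra.
        -- left. apply exp_increasing. assert (0 < (v * t) ^ 2) by now apply pow2_gt_0. nra.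
      * rewrite Rmult_1_r, <- (is_RInt_unique _ _ _ _ Hint).
        apply RInt_le; [lra|exact Hex|eexists; exact Hint|].
        intros v Hv. pose proof (exp_pos (- (t ^ 2 * (1 + v ^ 2)))).
        specialize (Hw v). unfold Rdiv. nra.
    + apply continuous_gauss.
    + intros u v. pose proof (pow2_ge_0 v).
      replace (2 * u * exp (- u ^ 2) * exp (- (u * v) ^ 2))
        with (2 * u * exp (- (u ^ 2 * (1 + v ^ 2)))).
      * auto_derive; change (v * (v * 1)) with (v ^ 2); change (u * (u * 1)) with (u ^ 2).
        -- nz.
        -- field; nz.
      * rewrite (Rmult_assoc (2 * u)), <- exp_plus. do 2 f_equal. ring.
    + apply Hc.
    + intros v. replace (- (0 ^ 2 * (1 + v ^ 2))) with 0 by ring.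
      rewrite exp_0. unfold Rdiv. ring.
    + exact Ht.
  - apply (filterlim_comp _ _ _ (fun t => exp (- t ^ 2)) (fun u => 1 - u) _ (locally 0)).
    + apply exp_neg_sqr_lim.
    + assert (Hc : continuous (fun u => 1 - u) 0)
        by (apply continuous_of_ex_derive; now auto_derive).
      unfold continuous in Hc. rewrite Rminus_0_r in Hc. exact Hc.
Qed.

(** The integral of [x^2 exp (- x^2)] over [[0, z]], integrated by parts. *)
Definition gauss_moment (z : R) : R := (gauss_primitive z - z * exp (- z ^ 2)) / 2.

Lemma is_derive_gauss_moment (z : R) :
  is_derive gauss_moment z (z ^ 2 * exp (- z ^ 2)).
Proof.
  assert (D1 := is_derive_primitive _ 0 z continuous_gauss).
  fold gauss_primitive in D1.
  assert (D2 : is_derive (fun z => z * exp (- z ^ 2)) z ((1 - 2 * z ^ 2) * exp (- z ^ 2))).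
  { auto_derive; [exact I|]. change (z * (z * 1)) with (z ^ 2). ring. }
  assert (D3 := is_derive_scal _ z (/ 2) _ (is_derive_minus _ _ _ _ _ D1 D2)).
  apply (is_derive_ext (fun z => / 2 * minus (gauss_primitive z) (z * exp (- z ^ 2)))).
  { intros t. unfold gauss_moment, minus, plus, opp; simpl. field. }
  eapply is_derive_eq; [|exact D3]. unfold minus, plus, opp; simpl. field.
Qed.

Lemma continuous_gauss_moment (z : R) : continuous gauss_moment z.
Proof.
  apply continuous_of_ex_derive.
  eexists. apply is_derive_gauss_moment.
Qed.

Lemma gauss_moment_incr (a b : R) : a <= b -> gauss_moment a <= gauss_moment b.
Proof.
  intros Hab.
  destruct (MVT_gen gauss_moment a b (fun z => z ^ 2 * exp (- z ^ 2))) as [c [_ Hc]].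
  - intros. apply is_derive_gauss_moment.
  - intros. apply continuity_pt_filterlim, continuous_gauss_moment.
  - pose proof (pow2_ge_0 c). pose proof (exp_pos (- c ^ 2)).
    assert (0 <= c ^ 2 * exp (- c ^ 2)) by (apply Rmult_le_pos; lra). nra.
Qed.

Lemma gauss_moment_lim :
  filterlim gauss_moment (Rbar_locally p_infty) (locally (sqrt PI / 4)).
Proof.
  assert (Hz : filterlim (fun z => z * exp (- z ^ 2)) (Rbar_locally p_infty) (locally 0)).
  { apply (filterlim_le_le (fun _ => 0) _ (fun z => / z) 0).
    - exists 1. intros z Hz. split.
      + apply Rmult_le_pos; [lra|apply Rlt_le, exp_pos].
      + rewrite exp_Ropp.
        assert (1 + z ^ 2 <= exp (z ^ 2)) by (left; apply exp_ineq1; nra).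
        apply Rle_trans with (z * / z ^ 2).
        * apply Rmult_le_compat_l; [lra|]. apply Rinv_le_contravar; nra.
        * apply Req_le. field. lra.
    - apply filterlim_const.
    - apply (is_lim_inv (fun z => z) p_infty p_infty); [apply is_lim_id|discriminate]. }
  unfold gauss_moment.
  replace (sqrt PI / 4) with ((sqrt (PI / 4 * 1) - 0) / 2).
  2:{ rewrite Rmult_1_r. unfold Rdiv at 2.
      rewrite sqrt_mult_alt by (left; apply PI_RGT_0).
      replace (/ 4) with (/ 2 * / 2) by field.
      rewrite sqrt_square by lra. field. }
  apply (filterlim_comp_2 (G := locally (sqrt (PI / 4 * 1))) (H := locally 0)
     gauss_primitive (fun z => z * exp (- z ^ 2)) (fun a b => (a - b) / 2));
    [apply gauss_primitive_lim|exact Hz|].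
  apply (filterlim_comp _ _ _ (fun ab : R * R => (fst ab) - (snd ab)) (fun u => u / 2) _
           (locally (sqrt (PI / 4 * 1) - 0))).
  - apply (filterlim_comp_2 (G := locally (sqrt (PI / 4 * 1))) (H := locally (opp 0))
      (fst : R * R -> R) (fun ab : R * R => opp (snd ab)) plus).
    + apply filterlim_fst.
    + apply (filterlim_comp _ _ _ (snd : R * R -> R) opp _ (locally 0)); [apply filterlim_snd|].
      apply (@filterlim_opp R_AbsRing R_NormedModule).
    + apply (@filterlim_plus R_AbsRing R_NormedModule).
  - apply (continuous_of_ex_derive (fun u => u / 2)). now auto_derive.
Qed.

Lemma gauss_moment_le_lim (z : R) : gauss_moment z <= sqrt PI / 4.
Proof.
  apply (filterlim_le (F := Rbar_locally p_infty) (fun _ => gauss_moment z) gauss_moment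
    (gauss_moment z) (sqrt PI / 4)).
  - exists z. intros t Ht. apply gauss_moment_incr. lra.
  - apply filterlim_const.
  - apply gauss_moment_lim.
Qed.

(** * The value of Gamma at 3/4 *)

Definition quartic_primitive (t : R) : R := RInt (fun w => w ^ 2 * exp (- w ^ 4)) 0 t.

Lemma continuous_quartic (w : R) : continuous (fun w => w ^ 2 * exp (- w ^ 4)) w.
Proof. apply continuous_of_ex_derive. now auto_derive. Qed.

(** This is [v^2 (1 + v^4)^(-3/2)], the angular density left once the radial
    variable of [w^2 exp (- w^4)] has been integrated out. *)
Definition polar_weight (v : R) : R := lemn_integrand v / (1 + v ^ 4).

Lemma continuous_polar_weight (v : R) : continuous polar_weight v.
Proof.
  pose proof (pow4_ge_0 v).
  apply (@continuous_mult R_UniformSpace R_AbsRing); [apply continuous_lemn_integrand|].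
  apply continuous_of_ex_derive.
  auto_derive. change (v * (v * (v * (v * 1)))) with (v ^ 4). nz.
Qed.

Lemma ex_RInt_polar_weight (a b : R) : ex_RInt polar_weight a b.
Proof.
  apply (@ex_RInt_continuous R_CompleteNormedModule). intros z _.
  apply continuous_polar_weight.
Qed.

Lemma polar_weight_ge_0 (v : R) : 0 <= polar_weight v.
Proof.
  pose proof (pow4_ge_0 v). pose proof (pow2_ge_0 v).
  assert (0 < sqrt (1 + v ^ 4)) by (apply sqrt_lt_R0; lra).
  unfold polar_weight, lemn_integrand.
  apply Rdiv_le_0_compat; [apply Rdiv_le_0_compat|]; lra.
Qed.

(** The weight is the difference of the first two moment integrands, and the
    first step of the moment recurrence evaluates that difference. *)
Lemma RInt_polar_weight : RInt polar_weight 0 1 = lemn_B / (2 * sqrt 2).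
Proof.
  assert (H2 : 0 < sqrt 2) by (apply sqrt_lt_R0; lra).
  rewrite lemn_B_moment.
  pose proof (lemn_moment_rec 0) as Hrec. simpl in Hrec.
  rewrite (RInt_ext _ (fun v => minus (lemn_integrand v * lemn_ratio v ^ 0)
                                      (lemn_integrand v * lemn_ratio v ^ 1))).
  2:{ intros v _. pose proof (pow4_ge_0 v).
      unfold polar_weight, lemn_ratio, minus, plus, opp; simpl.
      change (v * (v * (v * (v * 1)))) with (v ^ 4). field. nz. }
  rewrite (@RInt_minus R_CompleteNormedModule) by apply ex_RInt_lemn_moment.
  unfold lemn_moment in *.
  set (A := RInt (fun x => lemn_integrand x * lemn_ratio x ^ 0) 0 1) in *.
  set (B := RInt (fun x => lemn_integrand x * lemn_ratio x ^ 1) 0 1) in *.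
  clearbody A B. change (A - B = (1 - sqrt 2 * A) / (2 * sqrt 2)).
  apply (Rmult_eq_reg_r (2 * sqrt 2)); [|nz].
  unfold Rdiv. rewrite Rmult_assoc, Rinv_l by nz. lra.
Qed.

(** In [primitive_sqr], scaling the radial variable by [sqrt (1 + v^4)] gives a
    [gauss_moment] for every direction [v].  Its argument is at least [t^2], so
    its value lies between [gauss_moment (t^2)] and the limit
    [sqrt PI / 4], uniformly in [v]. *)
Lemma quartic_primitive_lim :
  filterlim quartic_primitive (Rbar_locally p_infty)
    (locally (sqrt (lemn_B / (2 * sqrt 2) * (sqrt PI / 4)))).
Proof.
  rewrite <- RInt_polar_weight.
  apply (filterlim_of_sqr_squeeze _ (fun t => gauss_moment (t ^ 2))).
  - intros t Ht. apply RInt_ge_0; [exact Ht| |].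
    + apply (@ex_RInt_continuous R_CompleteNormedModule). intros z _. apply continuous_quartic.
    + intros x _. apply Rmult_le_pos; [apply pow2_ge_0|apply Rlt_le, exp_pos].
  - intros t Ht.
    set (H := fun u v => polar_weight v * gauss_moment (sqrt (1 + v ^ 4) * u ^ 2)).
    assert (Hc : forall u v, continuous (H u) v).
    { intros u v. pose proof (pow4_ge_0 v).
      apply (@continuous_mult R_UniformSpace R_AbsRing); [apply continuous_polar_weight|].
      apply continuous_comp; [|apply continuous_gauss_moment].
      apply continuous_of_ex_derive.
      auto_derive. change (v * (v * (v * (v * 1)))) with (v ^ 4). nz. }
    assert (Hsq : forall v, 1 <= sqrt (1 + v ^ 4)).
    { intros v. rewrite <- sqrt_1 at 1. apply sqrt_le_1_alt. pose proof (pow4_ge_0 v). lra. }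
    unfold quartic_primitive. rewrite (primitive_sqr _ H).
    + assert (Hex : ex_RInt (H t) 0 1)
        by (apply (@ex_RInt_continuous R_CompleteNormedModule); intros z _; apply Hc).
      assert (Hmul : forall c, RInt polar_weight 0 1 * c = RInt (fun v => c * polar_weight v) 0 1).
      { intros c. rewrite Rmult_comm. symmetry.
        apply (@RInt_scal R_CompleteNormedModule), ex_RInt_polar_weight. }
      assert (Hex' : forall c, ex_RInt (fun v => c * polar_weight v) 0 1).
      { intros c. apply (@ex_RInt_scal R_CompleteNormedModule), ex_RInt_polar_weight. }
      rewrite !Hmul. split.
      * apply RInt_le; [lra|apply Hex'|exact Hex|]. intros v _. unfold H.
        rewrite Rmult_comm. apply Rmult_le_compat_l; [apply polar_weight_ge_0|].
        apply gauss_moment_incr. pose proof (Hsq v). pose proof (pow2_ge_0 t). nra.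
      * apply RInt_le; [lra|exact Hex|apply Hex'|]. intros v _. unfold H.
        rewrite Rmult_comm. apply Rmult_le_compat_r; [apply polar_weight_ge_0|].
        apply gauss_moment_le_lim.
    + apply continuous_quartic.
    + intros u v. unfold H. specialize (Hsq v). pose proof (pow4_ge_0 v).
      pose proof (sqrt_sqrt (1 + v ^ 4) ltac:(lra)) as Hss.
      assert (D1 : is_derive (fun u => sqrt (1 + v ^ 4) * u ^ 2) u (sqrt (1 + v ^ 4) * (2 * u)))
        by (auto_derive; [exact I|]; change (v * (v * (v * (v * 1)))) with (v ^ 4); ring).
      pose proof (is_derive_comp gauss_moment _ u _ _
        (is_derive_gauss_moment ((fun u => sqrt (1 + v ^ 4) * u ^ 2) u)) D1) as D2.
      pose proof (is_derive_scal _ u (polar_weight v) _ D2) as D3. cbv beta in D3.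
      eapply is_derive_eq; [|exact D3].
      set (s := sqrt (1 + v ^ 4)) in *.
      change (polar_weight v * (s * (2 * u) * ((s * u ^ 2) ^ 2 * exp (- (s * u ^ 2) ^ 2)))
        = 2 * u * (u ^ 2 * exp (- u ^ 4)) * ((u * v) ^ 2 * exp (- (u * v) ^ 4))).
      replace ((s * u ^ 2) ^ 2) with ((1 + v ^ 4) * u ^ 4) by (rewrite <- Hss; ring).
      replace (- ((1 + v ^ 4) * u ^ 4)) with (- u ^ 4 + - (u * v) ^ 4) by ring.
      rewrite exp_plus. unfold polar_weight, lemn_integrand. fold s. field. nz.
    + apply Hc.
    + intros v. unfold H. replace (sqrt (1 + v ^ 4) * 0 ^ 2) with 0 by ring.
      unfold gauss_moment, gauss_primitive. rewrite (@RInt_point R_CompleteNormedModule).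
      unfold zero; simpl. unfold Rdiv. ring.
    + exact Ht.
  - apply (filterlim_comp _ _ _ (fun t => t ^ 2) gauss_moment _ (Rbar_locally p_infty)).
    + intros P [M HM]. exists (Rmax 1 M). intros t Ht. apply HM.
      pose proof (Rmax_l 1 M). pose proof (Rmax_r 1 M). nra.
    + apply gauss_moment_lim.
Qed.

Lemma lemn_B_gt_0 : 0 < lemn_B.
Proof. rewrite lemn_B_moment. pose proof (lemn_moment_bounds 0). simpl in *. lra. Qed.

(** Substituting [t = w^4], where the fourth root is written as an iterated
    square root so that the antiderivative is continuous at [0]. *)
Lemma Gamma_3_4 :
  Gamma (3 / 4) = 4 * sqrt (lemn_B / (2 * sqrt 2) * (sqrt PI / 4)).
Proof.
  unfold Gamma. set (l := sqrt (lemn_B / _ * _)).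
  apply (@is_RInt_gen_unique R_CompleteNormedModule);
    [apply Proper_StrongProper, at_right_proper_filter
    |apply Proper_StrongProper, Rbar_locally_filter|].
  replace (4 * l) with (4 * l - 4 * quartic_primitive (sqrt (sqrt 0))).
  2:{ rewrite !sqrt_0. unfold quartic_primitive. rewrite (@RInt_point R_CompleteNormedModule).
      unfold zero; simpl. ring. }
  assert (Hs : forall t, continuous (fun t => sqrt (sqrt t)) t)
    by (intros t; apply continuous_comp; apply continuous_sqrt).
  assert (Dq : forall t : R, is_derive quartic_primitive t (t ^ 2 * exp (- t ^ 4)))
    by (intros t; apply (is_derive_primitive _ 0 t continuous_quartic)).
  apply (is_RInt_gen_primitive _ (fun t => 4 * quartic_primitive (sqrt (sqrt t))));
    [apply at_right_proper_filter|apply Rbar_locally_filter| | |].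
  - apply (Filter_prod _ _ _ (fun a => 0 < a) (fun b => 0 < b)).
    + exists (mkposreal 1 Rlt_0_1). intros; lra.
    + exists 0. intros; lra.
    + intros a b Ha Hb x. simpl. intros Hx.
      assert (Hx0 : 0 < x) by (apply Rlt_le_trans with (Rmin a b); [now apply Rmin_glb_lt|lra]).
      split.
      * pose proof (sqrt_lt_R0 x Hx0) as H1. pose proof (sqrt_lt_R0 _ H1) as H2.
        pose proof (sqrt_sqrt x ltac:(lra)) as H3.
        pose proof (sqrt_sqrt (sqrt x) ltac:(lra)) as H4.
        assert (D1 : is_derive (fun t => sqrt (sqrt t)) x (/ (4 * sqrt x * sqrt (sqrt x))))
          by (auto_derive; [nz|field; nz]).
        pose proof (is_derive_comp quartic_primitive _ x _ _
          (Dq ((fun t => sqrt (sqrt t)) x)) D1) as D2.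
        pose proof (is_derive_scal _ x 4 _ D2) as D3. cbv beta in D3.
        eapply is_derive_eq; [|exact D3].
        (* The exponent [- 1 / 4] is an inverse of two nested square roots. *)
        replace (3 / 4 - 1) with (/ 2 * / 2 * -(1)) by field.
        rewrite <- !Rpower_mult, !Rpower_sqrt by (try apply exp_pos; lra).
        rewrite Rpower_Ropp, Rpower_1 by lra.
        set (r := sqrt (sqrt x)) in *. set (w := sqrt x) in *.
        change (4 * (/ (4 * w * r) * (r ^ 2 * exp (- r ^ 4))) = / r * exp (- x)).
        replace (r ^ 4) with x by (rewrite <- H3, <- H4; ring).
        replace (r ^ 2) with w by (rewrite <- H4; ring). field. nz.
      * apply continuous_of_ex_derive. unfold Rpower.
        auto_derive. nz.
  - assert (Hc : continuous (fun t => 4 * quartic_primitive (sqrt (sqrt t))) 0).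
    { apply (@continuous_mult R_UniformSpace R_AbsRing); [apply continuous_const|].
      apply (continuous_comp (fun t => sqrt (sqrt t)) quartic_primitive); [apply Hs|].
      apply continuous_of_ex_derive. eexists. apply Dq. }
    eapply filterlim_filter_le_1; [apply filter_le_within|exact Hc].
  - apply (filterlim_comp _ _ _ (fun t => quartic_primitive (sqrt (sqrt t)))
             (fun u => 4 * u) _ (locally l)).
    + apply (filterlim_comp _ _ _ (fun t => sqrt (sqrt t)) quartic_primitive _ (Rbar_locally p_infty)).
      * apply (filterlim_comp _ _ _ sqrt sqrt _ (Rbar_locally p_infty)); apply filterlim_sqrt_p.
      * apply quartic_primitive_lim.
    + apply (@filterlim_scal_r R_AbsRing R_NormedModule).
Qed.

Lemma Gamma_3_4_lemniscate : Gamma (3 / 4) ^ 4 / (2 * PI) = lemn_B ^ 2.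
Proof.
  assert (H2 : 0 < sqrt 2) by (apply sqrt_lt_R0; lra).
  pose proof (sqrt_sqrt 2 ltac:(lra)) as H22.
  pose proof PI_RGT_0 as HPI. pose proof (sqrt_lt_R0 _ HPI) as Hp.
  pose proof (sqrt_sqrt PI ltac:(lra)) as Hpp.
  pose proof lemn_B_gt_0 as HB.
  rewrite Gamma_3_4. set (X := lemn_B / (2 * sqrt 2) * (sqrt PI / 4)).
  assert (HX : 0 <= X).
  { unfold X, Rdiv. repeat apply Rmult_le_pos; try lra.
    left; apply Rinv_0_lt_compat; lra. }
  replace ((4 * sqrt X) ^ 4) with (256 * (sqrt X * sqrt X) ^ 2) by ring.
  rewrite sqrt_sqrt by exact HX. unfold X.
  replace (256 * (lemn_B / (2 * sqrt 2) * (sqrt PI / 4)) ^ 2) with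
    (256 * lemn_B ^ 2 * (sqrt PI * sqrt PI) / (64 * (sqrt 2 * sqrt 2))) by (field; nz).
  rewrite Hpp, H22. field. nz.
Qed.

(** * Derivatives of primitives of Riemann integrable functions *)

Lemma increment_le_Int_SF (w : R -> R) (K : R) : forall lf l : list R,
  length l = S (length lf) ->
  (forall i, (i < length lf)%nat ->
     Rabs (w (pos_Rl l (S i)) - w (pos_Rl l i))
       <= K * (pos_Rl lf i * (pos_Rl l (S i) - pos_Rl l i))) ->
  Rabs (w (pos_Rl l (pred (length l))) - w (pos_Rl l 0)) <= K * Int_SF lf l.
Proof.
  induction lf as [|c lf IH]; intros l Hl Hi.
  - destruct l as [|x [|x' l]]; try discriminate. simpl.
    rewrite Rminus_eq_0, Rabs_R0. lra.
  - destruct l as [|x [|x' l]]; try discriminate.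
    injection Hl as Hl.
    specialize (IH (x' :: l)%list).
    assert (H1 := Hi 0%nat ltac:(simpl; lia)). simpl in H1.
    assert (H2 : Rabs (w (pos_Rl (x' :: l) (pred (length (x' :: l)))) - w x')
                 <= K * Int_SF lf (x' :: l)).
    { apply IH; [simpl; lia|]. intros i Hi'. apply (Hi (S i)). simpl. lia. }
    change (Int_SF (c :: lf) (x :: x' :: l)) with (c * (x' - x) + Int_SF lf (x' :: l)).
    change (pos_Rl (x :: x' :: l) (pred (length (x :: x' :: l)))) with
      (pos_Rl (x' :: l) (pred (length (x' :: l)))).
    change (pos_Rl (x :: x' :: l) 0) with x.
    set (z := pos_Rl (x' :: l) (pred (length (x' :: l)))) in *.
    replace (w z - w x) with ((w z - w x') + (w x' - w x)) by ring.
    eapply Rle_trans; [apply Rabs_triang|]. lra.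
Qed.

(** Difference quotients of [u] to the right of [x] are mean values of [g], so
    they lie within [r] of [m], and so does their limit. *)
Lemma derivative_near_integrand (g u : R -> R) (du m r c d x : R) :
  (forall x z, c < x -> x <= z -> z < d -> is_RInt g x z (u z - u x)) ->
  (forall t, c < t < d -> Rabs (g t - m) <= r) ->
  c < x < d -> is_derive u x du -> Rabs (du - m) <= r.
Proof.
  intros HI Hg Hx Hd.
  apply Rnot_lt_le. intros Hlt.
  apply is_derive_Reals in Hd.
  destruct (Hd (Rabs (du - m) - r) ltac:(lra)) as [delta Hdelta].
  pose proof (cond_pos delta) as Hpos.
  set (h := Rmin (delta / 2) ((d - x) / 2)).
  assert (Hh : 0 < h) by (apply Rmin_glb_lt; lra).
  assert (Hh1 : h <= delta / 2) by apply Rmin_l.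
  assert (Hh2 : h <= (d - x) / 2) by apply Rmin_r.
  specialize (Hdelta h ltac:(lra)). rewrite Rabs_pos_eq in Hdelta by lra.
  specialize (Hdelta ltac:(lra)).
  assert (HR : Rabs (u (x + h) - u x - h * m) <= h * r).
  { assert (HI1 := HI x (x + h) ltac:(lra) ltac:(lra) ltac:(lra)).
    assert (HI2 := is_RInt_minus _ _ _ _ _ _ HI1 (is_RInt_const x (x + h) m)).
    replace (h * r) with ((x + h - x) * r) by ring.
    apply (norm_RInt_le_const (V := R_NormedModule) (fun t => minus (g t) m) x (x + h)
              (u (x + h) - u x - h * m) r); [lra| |].
    - intros t Ht. apply Hg. lra.
    - replace (u (x + h) - u x - h * m)
        with (minus (u (x + h) - u x) (scal (x + h - x) m)); [exact HI2|].
      unfold minus, plus, opp, scal; simpl; unfold mult; simpl. ring. }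
  assert (HR' : Rabs ((u (x + h) - u x) / h - m) <= r).
  { replace ((u (x + h) - u x) / h - m) with ((u (x + h) - u x - h * m) / h) by (field; lra).
    unfold Rdiv. rewrite Rabs_mult, (Rabs_pos_eq (/ h)) by (left; now apply Rinv_0_lt_compat).
    apply (Rmult_le_reg_r h); [lra|]. rewrite Rmult_assoc, Rinv_l; lra. }
  assert (Rabs (du - m) <= Rabs ((u (x + h) - u x) / h - m)
            + Rabs ((u (x + h) - u x) / h - du)).
  { replace (du - m) with (((u (x + h) - u x) / h - m) - ((u (x + h) - u x) / h - du)) by ring.
    unfold Rminus at 1. eapply Rle_trans; [apply Rabs_triang|].
    rewrite Rabs_Ropp. lra. }
  lra.
Qed.

(** If [u] is a primitive of a Riemann integrable [g], then [u'] need not agree with [g]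
    where [g] is discontinuous; yet a function whose derivative is
    controlled by [|u' - g|] cannot vary.  On each interval of a subdivision
    where the integrand stays within [r] of a constant, [u'] does too, so that
    [|u' - g| <= 2 r] there; summing, the increment of [w] is at most [2 C]
    times the integral of the error step function, which is arbitrarily
    small. *)
Lemma constant_of_integrand_bound (g u du w dw : R -> R) (C a b : R) :
  a <= b -> 0 <= C ->
  (forall c d, a <= c -> c <= d -> d <= b -> is_RInt g c d (u d - u c)) ->
  (forall x, a <= x <= b -> is_derive u x (du x)) ->
  (forall x, a <= x <= b -> is_derive w x (dw x)) ->
  (forall x, a <= x <= b -> Rabs (dw x) <= C * Rabs (du x - g x)) ->
  w b = w a.
Proof.
  intros Hab HC HI Hu Hw Hdw.
  assert (Hg : ex_RInt g a b) by (eexists; apply HI; lra).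
  assert (Heps : forall eps : posreal, Rabs (w b - w a) <= 2 * C * eps).
  { intros eps.
    destruct (ex_RInt_Reals_0 g a b Hg eps) as [phi [psi [Hphi Hpsi]]].
    rewrite Rmin_left, Rmax_right in Hphi by lra.
    destruct (pre phi) as [l1 Hl1]. destruct (pre psi) as [l2 Hl2].
    destruct (StepFun_P22 Hab Hl1 Hl2) as [lf1 H1].
    destruct (StepFun_P24 Hab Hl1 Hl2) as [lf2 H2].
    (* The common refinement, on whose intervals both step functions are
       constant. *)
    set (l := cons_ORlist l1 l2) in *.
    assert (EI : RiemannInt_SF psi = Int_SF lf2 l).
    { unfold RiemannInt_SF. destruct (Rle_dec a b) as [_|]; [|contradiction].
      exact (StepFun_P17 (StepFun_P1 psi) H2). }
    destruct H1 as (Hord & Hfst & Hlast & Hlen1 & Hc1).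
    destruct H2 as (_ & _ & _ & Hlen2 & Hc2).
    rewrite Rmin_left in Hfst by lra. rewrite Rmax_right in Hlast by lra.
    assert (Hin : forall i, (i < length l)%nat -> a <= pos_Rl l i <= b).
    { intros i Hi. split.
      - rewrite <- Hfst. apply RList_P5; [exact Hord|]. apply RList_P3. eauto.
      - rewrite <- Hlast. apply RList_P7; [exact Hord|]. apply RList_P3. eauto. }
    assert (Hmain := increment_le_Int_SF w (2 * C) lf2 l Hlen2).
    rewrite Hfst, Hlast, <- EI in Hmain.
    apply Rle_trans with (2 * C * RiemannInt_SF psi).
    2:{ apply Rmult_le_compat_l; [lra|]. apply Rle_trans with (1 := Rle_abs _). lra. }
    apply Hmain. intros i Hi.
    assert (Hi1 : (i < pred (length l))%nat) by lia.
    specialize (Hc1 i Hi1). specialize (Hc2 i Hi1). specialize (Hord i Hi1).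
    assert (Hci := Hin i ltac:(lia)). assert (Hdi := Hin (S i) ltac:(lia)).
    set (c := pos_Rl l i) in *. set (d := pos_Rl l (S i)) in *.
    set (m := pos_Rl lf1 i) in *. set (r := pos_Rl lf2 i) in *.
    destruct (Req_dec c d) as [<-|Hcd].
    { rewrite !Rminus_eq_0, Rabs_R0. lra. }
    assert (Hgm : forall t, c < t < d -> Rabs (g t - m) <= r).
    { intros t Ht. rewrite <- (Hc1 t Ht), <- (Hc2 t Ht). apply Hphi. lra. }
    assert (Hdw' : forall t, c < t < d -> Rabs (dw t) <= 2 * C * r).
    { intros t Ht. eapply Rle_trans; [apply Hdw; lra|].
      assert (Rabs (du t - m) <= r).
      { apply (derivative_near_integrand g u (du t) m r c d t); auto.
        - intros; apply HI; lra.
        - apply Hu; lra. }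
      specialize (Hgm t Ht).
      assert (Rabs (du t - g t) <= 2 * r).
      { replace (du t - g t) with ((du t - m) - (g t - m)) by ring.
        unfold Rminus at 1. eapply Rle_trans; [apply Rabs_triang|].
        rewrite Rabs_Ropp. lra. }
      nra. }
    destruct (MVT_cor2 w dw c d ltac:(lra)) as [t [Et Ht]].
    { intros t Ht. apply is_derive_Reals, Hw. lra. }
    rewrite Et, Rabs_mult, (Rabs_pos_eq (d - c)) by lra.
    specialize (Hdw' t Ht). nra. }
  destruct (Req_dec (w b) (w a)) as [E|E]; [exact E|exfalso].
  assert (Hpos : 0 < Rabs (w b - w a)) by (apply Rabs_pos_lt; lra).
  set (e := Rabs (w b - w a) / (2 * C + 1)).
  assert (He : 0 < e) by (apply Rdiv_lt_0_compat; lra).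
  specialize (Heps (mkposreal e He)). simpl in Heps.
  assert (e * (2 * C + 1) = Rabs (w b - w a)) by (unfold e; field; lra).
  nra.
Qed.

(** * The differential equation of the interception curve *)

(** The positive root [v] of [v^2 = 1 + (s + x v)^2]: the value that the
    equation of the curve assigns to [s'], where [s = y / x] and
    [y' = s + x s']. *)
Definition ray_field (x s : R) : R := (s * x + sqrt (1 + s ^ 2 - x ^ 2)) / (1 - x ^ 2).

Lemma ray_field_radicand_gt_0 (x s : R) : 0 < x < 1 -> 0 < 1 + s ^ 2 - x ^ 2.
Proof. intros Hx. pose proof (pow2_ge_0 s). nra. Qed.

Lemma ray_field_fixpoint (x s : R) : 0 < x < 1 ->
  sqrt (1 + (s + x * ray_field x s) ^ 2) = ray_field x s.
Proof.
  intros Hx. assert (Hr := ray_field_radicand_gt_0 x s Hx).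
  pose proof (sqrt_lt_R0 _ Hr) as Hq. pose proof (sqrt_sqrt _ (Rlt_le _ _ Hr)) as Hqq.
  assert (Hd : 0 < 1 - x ^ 2) by nra.
  set (q := sqrt (1 + s ^ 2 - x ^ 2)) in *.
  assert (HF : 0 <= ray_field x s).
  { unfold ray_field. fold q. apply Rdiv_le_0_compat; [|lra].
    assert (0 < (1 + s ^ 2) * (1 - x ^ 2)) by (pose proof (pow2_ge_0 s); nra).
    assert ((s * x) ^ 2 < q ^ 2) by nra.
    destruct (Rle_lt_dec 0 (s * x)); [lra|]. nra. }
  rewrite <- (sqrt_pow2 (ray_field x s) HF). f_equal. rewrite sqrt_pow2 by exact HF.
  assert (E : (1 - x ^ 2) * ray_field x s = s * x + q)
    by (unfold ray_field; fold q; field; lra).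
  set (F := ray_field x s) in *. clearbody F.
  assert (E2 : (1 - x ^ 2) * (F ^ 2 - (1 + (s + x * F) ^ 2)) = 0).
  (* [ray_field] solves a quadratic equation in [F]; completing the square
     brings it back to the fixed point form. *)
  { transitivity (((1 - x ^ 2) * F - s * x) ^ 2 - (1 + s ^ 2 - x ^ 2)); [ring|].
    rewrite E. nra. }
  apply Rmult_integral in E2. destruct E2; lra.
Qed.

Lemma sqrt_1_plus_sqr_lipschitz (A B : R) :
  Rabs (sqrt (1 + A ^ 2) - sqrt (1 + B ^ 2)) <= Rabs (A - B).
Proof.
  pose proof (sqrt_1_plus_sqr_ge_1 A) as Ha. pose proof (sqrt_1_plus_sqr_ge_1 B) as Hb.
  pose proof (pow2_ge_0 A). pose proof (pow2_ge_0 B).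
  pose proof (sqrt_sqrt (1 + A ^ 2) ltac:(lra)) as Haa.
  pose proof (sqrt_sqrt (1 + B ^ 2) ltac:(lra)) as Hbb.
  set (a := sqrt (1 + A ^ 2)) in *. set (b := sqrt (1 + B ^ 2)) in *.
  assert (HAB : Rabs (A + B) <= a + b).
  { assert (Rabs A <= a) by (apply Rabs_le; nra).
    assert (Rabs B <= b) by (apply Rabs_le; nra).
    pose proof (Rabs_triang A B). lra. }
  apply (Rmult_le_reg_r (a + b)); [lra|].
  rewrite <- (Rabs_pos_eq (a + b)) at 1 by lra. rewrite <- Rabs_mult.
  replace ((a - b) * (a + b)) with ((A - B) * (A + B)) by nra.
  rewrite Rabs_mult. apply Rmult_le_compat_l; [apply Rabs_pos|exact HAB].
Qed.

(** The map [v |-> v - sqrt (1 + (s + x v)^2)] expands distances by at least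
    [1 - x], since [v |-> sqrt (1 + (s + x v)^2)] contracts them by [x], and it
    vanishes at [ray_field x s]. *)
Lemma ray_field_stability (x s v : R) : 0 < x < 1 ->
  (1 - x) * Rabs (v - ray_field x s) <= Rabs (v - sqrt (1 + (s + x * v) ^ 2)).
Proof.
  intros Hx. pose proof (ray_field_fixpoint x s Hx) as HF.
  set (F := ray_field x s) in *.
  pose proof (sqrt_1_plus_sqr_lipschitz (s + x * v) (s + x * F)) as HL.
  rewrite HF in HL.
  replace (s + x * v - (s + x * F)) with (x * (v - F)) in HL by ring.
  rewrite Rabs_mult, (Rabs_pos_eq x) in HL by lra.
  replace (v - F) with ((v - sqrt (1 + (s + x * v) ^ 2))
     + (sqrt (1 + (s + x * v) ^ 2) - F)) in HL |- * by ring.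
  pose proof (Rabs_triang (v - sqrt (1 + (s + x * v) ^ 2))
     (sqrt (1 + (s + x * v) ^ 2) - F)). lra.
Qed.

Lemma locally_unit_interval (x : R) : 0 < x < 1 -> locally x (fun b => 0 < b < 1).
Proof.
  intros Hx. apply (filter_and (fun b => 0 < b) (fun b => b < 1)).
  - apply (open_gt 0). lra.
  - apply (open_lt 1). lra.
Qed.

Definition ray_slope (y : R -> R) (x : R) : R := y x / x.
Definition arc_element (y : R -> R) (t : R) : R := sqrt (1 + Derive y t ^ 2).

Section Curve.

Variable y : R -> R.
Hypothesis Hy : interception_curve y.

Let s := ray_slope y.
Let g := arc_element y.

Lemma ray_slope_is_arc_length (x : R) : 0 < x < 1 -> is_RInt g 0 x (s x).
Proof. intros Hx. now apply Hy. Qed.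

Lemma ray_slope_increment (c d : R) :
  0 < c -> c <= d -> d < 1 -> is_RInt g c d (s d - s c).
Proof.
  intros Hc Hcd Hd.
  assert (H1 := is_RInt_swap _ _ _ _ (ray_slope_is_arc_length c ltac:(lra))).
  assert (H2 := ray_slope_is_arc_length d ltac:(lra)).
  assert (H3 := is_RInt_Chasles _ _ _ _ _ _ H1 H2).
  replace (s d - s c) with (plus (opp (s c)) (s d)); [exact H3|].
  unfold plus, opp; simpl. ring.
Qed.

Lemma is_derive_ray_slope_aux (x : R) : 0 < x < 1 ->
  is_derive s x ((Derive y x - s x) / x).
Proof.
  intros Hx. assert (Hd : ex_derive y x) by now apply Hy.
  unfold s, ray_slope. auto_derive; [nz; exact Hd|].
  change (fun x => y x) with y. field. lra.
Qed.

Lemma continuous_ray_field_ray_slope (x : R) : 0 < x < 1 ->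
  continuous (fun t => ray_field t (s t)) x.
Proof.
  intros Hx. apply continuous_of_ex_derive.
  assert (Hr := ray_field_radicand_gt_0 x (s x) Hx).
  assert (Hs : ex_derive s x) by (eexists; now apply is_derive_ray_slope_aux).
  unfold ray_field. auto_derive.
  change (x * (x * 1)) with (x ^ 2). change (s x * (s x * 1)) with (s x ^ 2).
  fold (Rminus 1 (x ^ 2)). fold (Rminus (1 + s x ^ 2) (x ^ 2)).
  repeat split; try exact Hs; try exact Hr. nra.
Qed.

(** The differential equation of the curve, at every point and not only where
    the arc length element is continuous.  The difference between [s] and the
    integral of [ray_field] along [s] has a derivative that
    [ray_field_stability] bounds by the gap between [s'] and the arc length
    element, so it is constant. *)
Lemma is_derive_ray_slope (x : R) : 0 < x < 1 ->
  is_derive s x (ray_field x (s x)).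
Proof.
  intros Hx.
  (* Any base point inside the unit interval would do. *)
  set (W := fun x => s x - RInt (fun t => ray_field t (s t)) (1 / 2) x).
  assert (HP : forall x, 0 < x < 1 ->
    is_derive (fun x => RInt (fun t => ray_field t (s t)) (1 / 2) x) x (ray_field x (s x))).
  { intros z Hz.
    apply (is_derive_RInt (fun t => ray_field t (s t)) _ (1 / 2) z);
      [|now apply continuous_ray_field_ray_slope].
    generalize (locally_unit_interval z ltac:(lra)). apply filter_imp. intros b Hb.
    apply (@RInt_correct R_CompleteNormedModule).
    apply (@ex_RInt_continuous R_CompleteNormedModule). intros t Ht.
    apply continuous_ray_field_ray_slope.
    pose proof (Rmin_glb_lt (1 / 2) b 0). pose proof (Rmax_lub_lt (1 / 2) b 1). lra. }
  assert (HW : forall x, 0 < x < 1 ->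
    is_derive W x ((Derive y x - s x) / x - ray_field x (s x))).
  { intros z Hz. apply (@is_derive_minus R_AbsRing R_NormedModule);
      [now apply is_derive_ray_slope_aux|now apply HP]. }
  assert (Hconst : forall a b, 0 < a -> a <= b -> b < 1 -> W b = W a).
  { intros a b Ha Hab Hb.
    apply (constant_of_integrand_bound g s (fun x => (Derive y x - s x) / x) W
      (fun x => (Derive y x - s x) / x - ray_field x (s x)) (/ (1 - b))); auto.
    - left. apply Rinv_0_lt_compat. lra.
    - intros. apply ray_slope_increment; lra.
    - intros. apply is_derive_ray_slope_aux; lra.
    - intros. apply HW; lra.
    - intros z Hz.
      pose proof (ray_field_stability z (s z) ((Derive y z - s z) / z) ltac:(lra)) as HS.
      replace (s z + z * ((Derive y z - s z) / z)) with (Derive y z) in HS by (field; lra).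
      change (sqrt (1 + Derive y z ^ 2)) with (g z) in HS.
      apply (Rmult_le_reg_l (1 - b)); [lra|].
      rewrite <- Rmult_assoc, Rinv_r, Rmult_1_l by lra.
      eapply Rle_trans; [|exact HS].
      apply Rmult_le_compat_r; [apply Rabs_pos|lra]. }
  assert (HW0 : is_derive W x 0).
  { apply (is_derive_ext_loc (fun _ => W x)); [|apply (@is_derive_const R_AbsRing R_NormedModule)].
    generalize (locally_unit_interval x ltac:(lra)). apply filter_imp. intros b Hb.
    destruct (Rle_lt_dec x b); [symmetry|]; apply Hconst; lra. }
  eapply is_derive_eq; [|now apply is_derive_ray_slope_aux].
  pose proof (is_derive_unique _ _ _ HW0) as E1.
  pose proof (is_derive_unique _ _ _ (HW x Hx)) as E2. rewrite E1 in E2. lra.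
Qed.

Let p := Derive y.

Lemma Derive_curve (x : R) : 0 < x < 1 -> p x = s x + x * ray_field x (s x).
Proof.
  intros Hx.
  pose proof (is_derive_unique _ _ _ (is_derive_ray_slope x Hx)) as E1.
  pose proof (is_derive_unique _ _ _ (is_derive_ray_slope_aux x Hx)) as E2.
  rewrite E1 in E2. rewrite E2. unfold p. field. lra.
Qed.

Lemma arc_element_field (x : R) : 0 < x < 1 -> sqrt (1 + p x ^ 2) = ray_field x (s x).
Proof. intros Hx. rewrite Derive_curve by exact Hx. now apply ray_field_fixpoint. Qed.

Lemma ray_slope_eq (x : R) : 0 < x < 1 -> s x = p x - x * sqrt (1 + p x ^ 2).
Proof. intros Hx. rewrite arc_element_field, (Derive_curve x) by exact Hx. ring. Qed.

(** The equation gains one derivative: it expresses [y'] as a smooth function of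
    [x] and of the differentiable function [y / x]. *)
Lemma ex_derive_slope (x : R) : 0 < x < 1 -> ex_derive p x.
Proof.
  intros Hx.
  assert (Hr := ray_field_radicand_gt_0 x (s x) Hx).
  assert (Hs : ex_derive s x) by (eexists; now apply is_derive_ray_slope_aux).
  apply (ex_derive_ext_loc (fun x => s x + x * ray_field x (s x))).
  { generalize (locally_unit_interval x ltac:(lra)). apply filter_imp. intros b Hb. symmetry. now apply Derive_curve. }
  unfold ray_field. auto_derive.
  change (x * (x * 1)) with (x ^ 2). change (s x * (s x * 1)) with (s x ^ 2).
  fold (Rminus 1 (x ^ 2)). fold (Rminus (1 + s x ^ 2) (x ^ 2)).
  repeat split; try exact Hs; try exact Hr. nra.
Qed.

(** The derivative of [s = p - x J], with [s' = J]. *)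
Lemma Derive_slope (x : R) : 0 < x < 1 ->
  (1 - x * p x / sqrt (1 + p x ^ 2)) * Derive p x = 2 * sqrt (1 + p x ^ 2).
Proof.
  intros Hx.
  pose proof (sqrt_1_plus_sqr_ge_1 (p x)) as HJ. pose proof (pow2_ge_0 (p x)) as Hp2.
  assert (Hp := ex_derive_slope x Hx).
  assert (D : is_derive (fun x => p x - x * sqrt (1 + p x ^ 2)) x
     (Derive p x - (sqrt (1 + p x ^ 2) + x * (p x * Derive p x / sqrt (1 + p x ^ 2))))).
  { auto_derive; change (p x * (p x * 1)) with (p x ^ 2).
    - repeat split; try exact Hp. lra.
    - change (fun x => p x) with p. field. nz. }
  assert (D' : is_derive s x
     (Derive p x - (sqrt (1 + p x ^ 2) + x * (p x * Derive p x / sqrt (1 + p x ^ 2))))).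
  { revert D. apply is_derive_ext_loc.
    generalize (locally_unit_interval x ltac:(lra)). apply filter_imp. intros b Hb. symmetry. now apply ray_slope_eq. }
  pose proof (is_derive_unique _ _ _ D') as E1.
  pose proof (is_derive_unique _ _ _ (is_derive_ray_slope x Hx)) as E2.
  rewrite E1, <- arc_element_field in E2 by exact Hx.
  set (J := sqrt (1 + p x ^ 2)) in *.
  transitivity (Derive p x - x * (p x * Derive p x / J)); [field; nz|lra].
Qed.

(** [Derive_slope] is a linear equation for [x] as a function of [p] with
    integrating factor [(1 + p^2)^(1/4)].  Working with [p] as a function of [x]
    spares the inversion of [p]. *)
Lemma is_derive_slope_invariant (x : R) : 0 < x < 1 ->
  is_derive (fun x => x * sqrt (sqrt (1 + p x ^ 2)) - slope_integral (p x)) x 0.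
Proof.
  intros Hx.
  pose proof (sqrt_1_plus_sqr_ge_1 (p x)) as HJ. pose proof (pow2_ge_0 (p x)) as Hp2.
  assert (Hp := ex_derive_slope x Hx). assert (HE := Derive_slope x Hx).
  assert (Hj : 0 < sqrt (sqrt (1 + p x ^ 2))) by (apply sqrt_lt_R0; lra).
  pose proof (sqrt_sqrt (sqrt (1 + p x ^ 2)) ltac:(lra)) as Hjj.
  assert (D1 : is_derive (fun x => x * sqrt (sqrt (1 + p x ^ 2))) x
     (sqrt (sqrt (1 + p x ^ 2))
      + x * p x * Derive p x / (2 * sqrt (1 + p x ^ 2) * sqrt (sqrt (1 + p x ^ 2))))).
  { auto_derive; change (p x * (p x * 1)) with (p x ^ 2).
    - repeat split; try exact Hp; lra.
    - change (fun x => p x) with p. field. nz. }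
  pose proof (is_derive_comp slope_integral p x _ _
    (is_derive_slope_integral (p x)) (Derive_correct p x Hp)) as D2.
  pose proof (is_derive_minus _ _ _ _ _ D1 D2) as D. cbv beta in D.
  eapply is_derive_eq; [|exact D].
  set (j := sqrt (sqrt (1 + p x ^ 2))) in *. set (J := sqrt (1 + p x ^ 2)) in *.
  change (j + x * p x * Derive p x / (2 * J * j) - Derive p x * / (2 * j) = 0).
  transitivity ((2 * (j * j) - (1 - x * p x / J) * Derive p x) / (2 * j)).
  - field. nz.
  - rewrite HE, Hjj. field. nz.
Qed.

Lemma ray_slope_ge (x : R) : 0 < x < 1 -> x <= s x.
Proof.
  intros Hx.
  assert (H := is_RInt_le (fun _ => 1) g 0 x (x - 0) (s x)).
  rewrite Rminus_0_r in H. apply H; [lra| |now apply ray_slope_is_arc_length|].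
  - pose proof (is_RInt_const 0 x 1) as Hc.
    unfold scal in Hc; simpl in Hc; unfold mult in Hc; simpl in Hc.
    now rewrite Rminus_0_r, Rmult_1_r in Hc.
  - intros. apply sqrt_1_plus_sqr_ge_1.
Qed.

(** Extending the arc length element by zero to the left of [0] makes its
    primitive defined on both sides of [0], and primitives of Riemann integrable
    functions are continuous. *)
Lemma ray_slope_lim_0 : filterlim s (at_right 0) (locally 0).
Proof.
  set (g0 := fun t => if Rlt_dec t 0 then 0 else g t).
  set (s0 := fun x => if Rlt_dec 0 x then s x else 0).
  assert (Hc : continuous s0 0).
  { apply (continuous_RInt_0 g0).
    exists (mkposreal 1 Rlt_0_1). intros x Hx.
    apply ball_Rabs_def2 in Hx; simpl in Hx. unfold s0. destruct (Rlt_dec 0 x) as [Hx0|Hx0].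
    - apply (is_RInt_ext g); [|apply ray_slope_is_arc_length; lra].
      rewrite Rmin_left, Rmax_right by lra. intros t Ht. unfold g0.
      destruct (Rlt_dec t 0); [lra|reflexivity].
    - apply (is_RInt_ext (fun _ => 0)).
      + rewrite Rmin_right, Rmax_left by lra. intros t Ht. unfold g0.
        destruct (Rlt_dec t 0); [reflexivity|lra].
      + pose proof (is_RInt_const (V := R_NormedModule) 0 x 0) as Hz.
        unfold scal in Hz; simpl in Hz; unfold mult in Hz; simpl in Hz.
        now rewrite Rmult_0_r in Hz. }
  apply (filterlim_ext_loc s0).
  - exists (mkposreal 1 Rlt_0_1). intros x _ Hx. unfold s0.
    destruct (Rlt_dec 0 x); [reflexivity|lra].
  - replace 0 with (s0 0) at 2 by (unfold s0; destruct (Rlt_dec 0 0); [lra|reflexivity]).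
    eapply filterlim_filter_le_1; [apply filter_le_within|exact Hc].
Qed.

Lemma at_right_0_unit : at_right 0 (fun x => 0 < x < 1 / 2).
Proof.
  exists (mkposreal (1 / 2) ltac:(lra)). intros x Hx Hx0.
  apply ball_Rabs_def2 in Hx; simpl in Hx. lra.
Qed.

(** For [x <= 1/2] the field is at most [2 + 3 s], so that
    [p <= s + x (2 + 3 s)]. *)
Lemma slope_lim_0 : filterlim p (at_right 0) (locally 0).
Proof.
  apply (filterlim_le_le (fun _ => 0) _ (fun x => 3 * s x + 2 * x) 0).
  - generalize at_right_0_unit. apply filter_imp. intros x Hx.
    assert (Hx1 : 0 < x < 1) by lra.
    assert (Hs := ray_slope_ge x Hx1).
    rewrite Derive_curve by exact Hx1. set (u := s x) in *. clearbody u.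
    assert (Hr := ray_field_radicand_gt_0 x u Hx1).
    assert (Hq : 0 <= sqrt (1 + u ^ 2 - x ^ 2) <= 1 + u).
    { split; [apply sqrt_pos|]. rewrite <- (sqrt_pow2 (1 + u)) by lra.
      apply sqrt_le_1_alt. nra. }
    unfold ray_field. set (q := sqrt (1 + u ^ 2 - x ^ 2)) in *.
    assert (HF : 0 <= (u * x + q) / (1 - x ^ 2) <= 2 * (1 + 3 / 2 * u)).
    { split; [apply Rdiv_le_0_compat; nra|].
      apply (Rmult_le_reg_r (1 - x ^ 2)); [nra|].
      unfold Rdiv at 1. rewrite Rmult_assoc, Rinv_l by nra.
      assert (u * x <= u * (1 / 2)) by (apply Rmult_le_compat_l; lra).
      assert ((2 + 3 * u) * (3 / 4) <= (2 + 3 * u) * (1 - x ^ 2))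
        by (apply Rmult_le_compat_l; nra). lra. }
    set (F := (u * x + q) / (1 - x ^ 2)) in *. split; nra.
  - apply filterlim_const.
  - assert (H1 : filterlim (fun x => 3 * s x) (at_right 0) (locally (3 * 0))).
    { apply (filterlim_comp _ _ _ s (fun u => 3 * u) _ (locally 0));
        [apply ray_slope_lim_0|apply (@filterlim_scal_r R_AbsRing R_NormedModule)]. }
    assert (H2 : filterlim (fun x => 2 * x) (at_right 0) (locally (2 * 0))).
    { eapply filterlim_filter_le_1; [apply filter_le_within|].
      apply (@filterlim_scal_r R_AbsRing R_NormedModule). }
    replace 0 with (plus (3 * 0) (2 * 0)) at 2 by (unfold plus; simpl; ring).
    apply (filterlim_comp_2 _ _ plus H1 H2), (@filterlim_plus R_AbsRing R_NormedModule).
Qed.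

(** The invariant has limit [0] at the origin, because [p] does. *)
Lemma slope_parametrization (x : R) : 0 < x < 1 ->
  x * sqrt (sqrt (1 + p x ^ 2)) = slope_integral (p x).
Proof.
  set (h := fun x => x * sqrt (sqrt (1 + p x ^ 2)) - slope_integral (p x)).
  intros Hx.
  assert (Hconst : forall a b, 0 < a -> a < b -> b < 1 -> h b = h a).
  { intros a b Ha Hab Hb. apply constant_of_derive_0; [exact Hab| |].
    - intros t Ht. apply is_derive_slope_invariant. lra.
    - intros t Ht. apply continuity_pt_filterlim.
      apply (continuous_of_ex_derive h t).
      exists 0. apply is_derive_slope_invariant. lra. }
  assert (L1 : filterlim h (at_right 0) (locally (h x))).
  { apply (filterlim_ext_loc (fun _ => h x)); [|apply filterlim_const].
    exists (mkposreal x (proj1 Hx)). intros t Ht Ht0.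
    apply ball_Rabs_def2 in Ht; simpl in Ht. apply Hconst; lra. }
  assert (L2 : filterlim h (at_right 0) (locally 0)).
  { assert (La : filterlim (fun x => sqrt (sqrt (1 + p x ^ 2))) (at_right 0) (locally 1)).
    { apply (filterlim_comp _ _ _ p (fun u => sqrt (sqrt (1 + u ^ 2))) _ (locally 0));
        [apply slope_lim_0|].
      assert (Hc : continuous (fun u => sqrt (sqrt (1 + u ^ 2))) 0).
      { apply continuous_comp; [|apply continuous_sqrt].
        apply continuous_comp; [|apply continuous_sqrt].
        apply continuous_of_ex_derive. now auto_derive. }
      unfold continuous in Hc. replace (1 + 0 ^ 2) with 1 in Hc by ring.
      now rewrite !sqrt_1 in Hc. }
    assert (Lb : filterlim (fun x => slope_integral (p x)) (at_right 0) (locally 0)).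
    { apply (filterlim_comp _ _ _ p slope_integral _ (locally 0)); [apply slope_lim_0|].
      replace 0 with (slope_integral 0) at 2 by apply (@RInt_point R_CompleteNormedModule).
      apply (continuous_of_ex_derive slope_integral 0).
      eexists. apply is_derive_slope_integral. }
    assert (Lid : filterlim (fun x : R => x) (at_right 0) (locally 0))
      by (apply filter_le_within).
    assert (Lc : filterlim (fun x => x * sqrt (sqrt (1 + p x ^ 2))) (at_right 0) (locally (0 * 1)))
      by (apply (filterlim_comp_2 _ _ Rmult Lid La), (@filterlim_mult R_AbsRing)).
    assert (Ld : filterlim (fun x => opp (slope_integral (p x))) (at_right 0) (locally (opp 0)))
      by (apply (filterlim_comp _ _ _ _ opp _ _ _ Lb), (@filterlim_opp R_AbsRing R_NormedModule)).
    replace 0 with (plus (0 * 1) (opp 0)) at 2 by (unfold plus, opp; simpl; ring).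
    apply (filterlim_comp_2 _ _ plus Lc Ld), (@filterlim_plus R_AbsRing R_NormedModule). }
  assert (E : h x = 0).
  { apply (filterlim_locally_unique (F := at_right 0) h (h x) 0 L1 L2). }
  unfold h in E. lra.
Qed.

(** Since [s >= x], the field is at least [x^2 / (1 - x^2)], which blows up
    at [1]. *)
Lemma slope_lim_1 : filterlim p (at_left 1) (Rbar_locally p_infty).
Proof.
  intros P [M HM].
  (* For [x >= 1/2] the field is at least [1 / (8 (1 - x))], which the second
     bound on [1 - x] makes at least [2 max (1, M)]. *)
  set (e := Rmin (1 / 2) (/ (16 * Rmax 1 M))).
  pose proof (Rmax_l 1 M) as HM1. pose proof (Rmax_r 1 M) as HM2.
  assert (He : 0 < e)
    by (apply Rmin_glb_lt; [lra|apply Rinv_0_lt_compat; lra]).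
  exists (mkposreal e He). intros x Hx Hx1. apply HM.
  apply ball_Rabs_def2 in Hx; simpl in Hx.
  assert (e <= 1 / 2) by apply Rmin_l.
  assert (He2 : e <= / (16 * Rmax 1 M)) by apply Rmin_r.
  assert (Hx2 : 0 < x < 1) by lra.
  assert (Hs := ray_slope_ge x Hx2).
  rewrite Derive_curve by exact Hx2. set (u := s x) in *. clearbody u.
  assert (HMx : 16 * Rmax 1 M * (1 - x) < 1).
  { apply Rlt_le_trans with (16 * Rmax 1 M * e); [apply Rmult_lt_compat_l; lra|].
    apply Rle_trans with (16 * Rmax 1 M * / (16 * Rmax 1 M)); [apply Rmult_le_compat_l; lra|].
    rewrite Rinv_r; lra. }
  assert (HF : 2 * Rmax 1 M <= ray_field x u).
  { unfold ray_field. pose proof (sqrt_pos (1 + u ^ 2 - x ^ 2)).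
    set (q := sqrt (1 + u ^ 2 - x ^ 2)) in *.
    apply (Rmult_le_reg_r (1 - x ^ 2)); [nra|].
    replace ((u * x + q) / (1 - x ^ 2) * (1 - x ^ 2)) with (u * x + q) by (field; nra).
    assert (16 * Rmax 1 M * (1 - x) * (1 + x) <= 1 * (1 + x))
      by (apply Rmult_le_compat_r; lra).
    assert (x * x <= u * x) by (apply Rmult_le_compat_r; lra).
    set (m := Rmax 1 M) in *. nra. }
  assert (x * (2 * Rmax 1 M) <= x * ray_field x u) by (apply Rmult_le_compat_l; lra).
  set (m := Rmax 1 M) in *. nra.
Qed.

(** The quantity is [|PT| - |TQ|].  By [slope_parametrization] it is the square
    of [sqrt J - I p], whose limit is [slope_defect_lim]. *)
Lemma gap_lim :
  filterlim (fun x => (1 - x) ^ 2 * sqrt (1 + p x ^ 2)) (at_left 1) (locally (lemn_B ^ 2)).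
Proof.
  apply (filterlim_ext_loc
    (fun x => (sqrt (sqrt (1 + p x ^ 2)) - slope_integral (p x)) ^ 2)).
  { generalize at_left_1_unit. apply filter_imp. intros x Hx.
    rewrite <- slope_parametrization by exact Hx.
    pose proof (sqrt_1_plus_sqr_ge_1 (p x)).
    rewrite <- (sqrt_sqrt (sqrt (1 + p x ^ 2))) at 3 by lra. ring. }
  apply (filterlim_comp _ _ _
    (fun x => sqrt (sqrt (1 + p x ^ 2)) - slope_integral (p x)) (fun u => u ^ 2) _ (locally lemn_B)).
  - apply (filterlim_comp _ _ _ p (fun p => sqrt (sqrt (1 + p ^ 2)) - slope_integral p)
             _ (Rbar_locally p_infty)); [apply slope_lim_1|apply slope_defect_lim].
  - apply (continuous_of_ex_derive (fun u => u ^ 2) lemn_B).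
    now auto_derive.
Qed.

End Curve.

(** * The limits of the side lengths *)

Theorem theorem3 (y : R -> R) (Q T : R -> point)
  (Hy : interception_curve y)
  (HQ : forall x : R, 0 < x < 1 ->
     line_through origin (graph_point y x) (Q x) /\ vertical_line 1 (Q x))
  (HT : forall x : R, 0 < x < 1 ->
     tangent_line y x (T x) /\ vertical_line 1 (T x)) :
  let B := second_lemniscate_constant in
  filterlim (fun x => euclid_dist (graph_point y x) (Q x))
    (at_left 1) (locally (B ^ 2)) /\
  filterlim (fun x => euclid_dist (graph_point y x) (T x) - euclid_dist (T x) (Q x))
    (at_left 1) (locally (B ^ 2)) /\
  Gamma (3 / 4) ^ 4 / (2 * PI) = B ^ 2 /\
  Rabs (B ^ 2 - 0.3588850048) < 1 / 10 ^ 9.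
Proof.
  intros B. unfold B. rewrite second_lemniscate_constant_eq. clear B.
  assert (EQ : forall x, 0 < x < 1 -> Q x = (1, ray_slope y x)).
  { intros x Hx. destruct (HQ x Hx) as [[t Ht] Hv].
    unfold vertical_line in Hv. rewrite Ht in Hv |- *. simpl in *.
    unfold ray_slope. f_equal; [exact Hv|].
    replace t with (/ x); [field; lra|].
    apply (Rmult_eq_reg_r x); [|lra]. rewrite Rinv_l; lra. }
  assert (ET : forall x, 0 < x < 1 -> T x = (1, y x + (1 - x) * Derive y x)).
  { intros x Hx. destruct (HT x Hx) as [[t Ht] Hv].
    unfold vertical_line in Hv. rewrite Ht in Hv |- *. simpl in *.
    f_equal; [exact Hv|]. replace t with (1 - x) by lra. reflexivity. }
  assert (Ey : forall x, 0 < x < 1 -> y x = x * ray_slope y x).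
  { intros x Hx. unfold ray_slope. field. lra. }
  split; [|split; [|split; [apply Gamma_3_4_lemniscate|apply lemn_B_sqr_approx]]].
  - apply (filterlim_le_le
      (fun x => (1 - x) ^ 2 * sqrt (1 + Derive y x ^ 2) + (x - 1)) _
      (fun x => (1 - x) ^ 2 * sqrt (1 + Derive y x ^ 2) + (1 - x)) (lemn_B ^ 2)).
    + generalize at_left_1_unit. apply filter_imp. intros x Hx.
      rewrite EQ by exact Hx. unfold euclid_dist, dist_euc; simpl fst; simpl snd.
      rewrite (Ey x Hx).
      assert (Hge := ray_slope_ge y Hy x Hx).
      assert (Hs := ray_slope_eq y Hy x Hx).
      set (s := ray_slope y x) in *. set (p := Derive y x) in *.
      pose proof (sqrt_1_plus_sqr_ge_1 p). pose proof (pow2_ge_0 p).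
      pose proof (sqrt_sqrt (1 + p ^ 2) ltac:(lra)) as HJJ.
      set (J := sqrt (1 + p ^ 2)) in *.
      assert (HJ : 0 <= J - p <= 1).
      { assert (0 < x * J) by (apply Rmult_lt_0_compat; lra).
        assert (0 < p) by lra. split; nra. }
      assert (Hd : (1 - x) * s = (1 - x) ^ 2 * J - (1 - x) * (J - p)) by (rewrite Hs; ring).
      assert (Hb : 0 <= (1 - x) * (J - p) <= 1 - x) by (split; nra).
      assert (Hs0 : 0 <= (1 - x) * s) by nra.
      set (d := (1 - x) * s) in *.
      (* [|PQ|] is the hypotenuse for the legs [1 - x] and [d], so it lies between
         [d] and [d + (1 - x)]. *)
      replace (Rsqr (x - 1) + Rsqr (x * s - s)) with ((1 - x) ^ 2 + d ^ 2)
        by (unfold Rsqr, d; ring).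
      split.
      * apply Rle_trans with d; [lra|].
        rewrite <- (sqrt_pow2 d) at 1 by exact Hs0. apply sqrt_le_1_alt. nra.
      * apply Rle_trans with (d + (1 - x)); [|lra].
        rewrite <- (sqrt_pow2 (d + (1 - x))) by lra. apply sqrt_le_1_alt. nra.
    + assert (Hc : filterlim (fun x => x - 1) (at_left 1) (locally (1 - 1))).
      { apply (filterlim_at_left_continuous (fun x => x - 1)).
        apply continuous_of_ex_derive. now auto_derive. }
      replace (lemn_B ^ 2) with (plus (lemn_B ^ 2) (1 - 1)) by (unfold plus; simpl; ring).
      apply (filterlim_comp_2 _ _ plus (gap_lim y Hy) Hc),
        (@filterlim_plus R_AbsRing R_NormedModule).
    + assert (Hc : filterlim (fun x => 1 - x) (at_left 1) (locally (1 - 1))).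
      { apply (filterlim_at_left_continuous (fun x => 1 - x)).
        apply continuous_of_ex_derive. now auto_derive. }
      replace (lemn_B ^ 2) with (plus (lemn_B ^ 2) (1 - 1)) by (unfold plus; simpl; ring).
      apply (filterlim_comp_2 _ _ plus (gap_lim y Hy) Hc),
        (@filterlim_plus R_AbsRing R_NormedModule).
  - apply (filterlim_ext_loc (fun x => (1 - x) ^ 2 * sqrt (1 + Derive y x ^ 2)));
      [|now apply gap_lim].
    generalize at_left_1_unit. apply filter_imp. intros x Hx.
    rewrite EQ, ET by exact Hx. unfold euclid_dist, dist_euc; simpl fst; simpl snd.
    assert (Hs := ray_slope_eq y Hy x Hx).
    rewrite (Ey x Hx), Hs. set (p := Derive y x).
    pose proof (sqrt_1_plus_sqr_ge_1 p). pose proof (pow2_ge_0 p).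
    replace (Rsqr (x - 1) + Rsqr _) with ((1 - x) ^ 2 * (1 + p ^ 2))
      by (unfold Rsqr; ring).
    set (J := sqrt (1 + p ^ 2)) in *.
    replace (Rsqr (1 - 1) + Rsqr _) with (((1 - x) * (x * J)) ^ 2) by (unfold Rsqr; ring).
    rewrite sqrt_mult_alt by apply pow2_ge_0. fold J.
    rewrite (sqrt_pow2 (1 - x)) by lra.
    rewrite sqrt_pow2 by (repeat apply Rmult_le_pos; lra).
    ring.
Qed.
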